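(* Let $A$ be a $\mathbb{K}$-algebra over a field $\mathbb{K}$ and let $(H,\Delta,\epsilon)$ be a left bialgebroid over $A$. Then $(\Delta,\epsilon)$ descend to a well-defined coalgebra structure (in $A$-bimodules) on $H\boxtimes A$. If moreover $H$ is left Hopf (i.e. the map $\beta$ in the context is invertible), then the coalgebra $H\boxtimes A$ has a lax braiding in the monoidal category ${}_{H}\mathcal{M}$ of left $H$-modules, given for every left $H$-module $(M,\triangleright)$ by the well-defined map $$(H\boxtimes A)\otimes_A M\to M\otimes_A(H\boxtimes A),\qquad (h\boxtimes a)\otimes_A m\mapsto \big(h_{(+)(1)}\,a\,h_{(-)}\triangleright m\big)\otimes_A(h_{(+)(2)}\boxtimes 1).$$
   Context: Write $A^{e}=A\otimes_{\mathbb{K}}A^{\mathrm{op}}$ with elements $a\overline{b}$; $A$-bimodules are left $A^e$-modules ($a\overline b m=amb$). For an $A^e$-bimodule $H$, $|H$ denotes $H$ as an $A$-bimodule through its left $A^e$-action, and $H\boxtimes M:=H\otimes_{A^e}M$, an $A$-bimodule through the left $A^e$-action on $H$. Thus $H\boxtimes A$ is the quotient of $H$ by the left ideal generated by $\{a-\overline a\mid a\in A\}$; it is a left $H$-module. A left $A$-bialgebroid is an $A^e$-bimodule $H$ with: a $\mathbb{K}$-algebra structure and an algebra map $\eta:A^e\to H$ inducing the bimodule structure by multiplication; $A$-bimodule maps $\Delta:|H\to|H\otimes_A|H$, $h\mapsto h_{(1)}\otimes_A h_{(2)}$, and $\epsilon:|H\to A$ making $|H$ a comonoid in $A$-bimodules,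 with $\Delta(hr\overline s)=h_{(1)}r\otimes_A h_{(2)}\overline s$ and $\epsilon(hr)=\epsilon(h\overline r)$ for $r,s\in A$; and $\Delta(hh')=h_{(1)}h'_{(1)}\otimes_A h_{(2)}h'_{(2)}$, $\Delta(1)=1\otimes_A 1$, $\epsilon(1)=1$, $\epsilon(hh')=\epsilon(h\,\epsilon(h'))=\epsilon(h\,\overline{\epsilon(h')})$. $\beta:H\otimes_{A^{\mathrm{op}}}H\to H\diamond H$ is $h\otimes h'\mapsto h_{(1)}\diamond h_{(2)}h'$, where $H\otimes_{A^{\mathrm{op}}}H$ and $H\diamond H$ are the quotients of $H\otimes_{\mathbb{K}}H$ by the relations $h\overline s\otimes h'=h\otimes\overline s h'$ and $\overline s h\otimes h'=h\otimes sh'$ respectively. When $\beta$ is invertible write $\beta^{-1}(h\diamond 1)=h_{(+)}\otimes_{A^{\mathrm{op}}}h_{(-)}$. ${}_{H}\mathcal{M}$ is monoidal: an $H$-module is an $A$-bimodule via $\eta$, the tensor product is $\otimes_A$ with $h\triangleright(m\otimes n)=h_{(1)}m\otimes_A h_{(2)}n$, the unit is $A$. A lax braiding on a coalgebra $C$ in ${}_{H}\mathcal{M}$ is a (not necessarily invertible) natural transformation $\tau_M:C\otimes_A M\to M\otimes_A C$ of $H$-modules with $\tau_{M\otimes N}=(\mathrm{id}_M\otimes\tau_N)(\tau_M\otimes\mathrm{id}_N)$ and $\tau_A=\mathrm{id}$, such that $(\tau_M\otimes\mathrm{id}_C)(\mathrm{id}_C\otimes\tau_M)(\Delta_C\otimes\mathrm{id}_M)=(\mathrm{id}_M\otimes\Delta_C)\tau_M$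 and $(\mathrm{id}_M\otimes\epsilon_C)\tau_M=\epsilon_C\otimes\mathrm{id}_M$. *)

(* Defs.v *)
From HB Require Import structures.
From mathcomp Require Import all_boot all_algebra generic_quotient boolp.

Set Implicit Arguments.
Unset Strict Implicit.
Unset Printing Implicit Defensive.

Import GRing.Theory.
Local Open Scope ring_scope.
Local Open Scope quotient_scope.

(* The tensor product of two abelian groups X and Y balanced over a family of *)
(* operations: the abelian group generated by the pairs (x, y), with x + x'   *)
(* and y + y' bilinear, and (ra i x, y) = (x, la i y). When I is a ring R     *)
(* acting on X from the right and on Y from the left this is X (x)_R Y.       *)
(* Formal sums are lists, so -(x, y) is (- x, y).                             *)
Section Tensor.
Variables (I : Type) (X Y : zmodType) (ra : I -> X -> X) (la : I -> Y -> Y).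

Inductive tensor_eq : seq (X * Y) -> seq (X * Y) -> Prop :=
| tensor_eq_refl s : tensor_eq s s
| tensor_eq_sym s t : tensor_eq s t -> tensor_eq t s
| tensor_eq_trans s t u : tensor_eq s t -> tensor_eq t u -> tensor_eq s u
| tensor_eq_cat s s' t t' :
    tensor_eq s s' -> tensor_eq t t' -> tensor_eq (s ++ t) (s' ++ t')
| tensor_eq_catC s t : tensor_eq (s ++ t) (t ++ s)
| tensor_eq_addl x x' y : tensor_eq [:: (x + x', y)] [:: (x, y); (x', y)]
| tensor_eq_addr x y y' : tensor_eq [:: (x, y + y')] [:: (x, y); (x, y')]
| tensor_eq_0l y : tensor_eq [:: (0, y)] [::]
| tensor_eq_bal i x y : tensor_eq [:: (ra i x, y)] [:: (x, la i y)].

Definition tensor_eqb : rel (seq (X * Y)) := fun s t => `[< tensor_eq s t >].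

Lemma tensor_eqb_refl : reflexive tensor_eqb.
Proof. by move=> s; apply/asboolP; exact: tensor_eq_refl. Qed.

Lemma tensor_eqb_sym : symmetric tensor_eqb.
Proof.
by move=> s t; apply/asboolP/asboolP; exact: tensor_eq_sym.
Qed.

Lemma tensor_eqb_trans : transitive tensor_eqb.
Proof.
move=> t s u /asboolP st /asboolP tu; apply/asboolP.
exact: tensor_eq_trans tu.
Qed.

Canonical tensor_equiv :=
  EquivRel tensor_eqb tensor_eqb_refl tensor_eqb_sym tensor_eqb_trans.

Definition tensor : Type := {eq_quot tensor_equiv}.

HB.instance Definition _ := Choice.on tensor.
HB.instance Definition _ := Quotient.on tensor.
HB.instance Definition _ : EqQuotient _ tensor_equiv tensor :=
  EqQuotient.on tensor.

Lemma tensor_piP (s t : seq (X * Y)) :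
  (\pi_tensor s = \pi_tensor t) <-> tensor_eq s t.
Proof.
split=> [/eqP|st]; first by rewrite piE => /asboolP.
by apply/eqP; rewrite piE; apply/asboolP.
Qed.

Lemma tensor_eq_repr (s : seq (X * Y)) : tensor_eq (repr (\pi_tensor s)) s.
Proof. by apply/tensor_piP; rewrite reprK. Qed.

Let opps (s : seq (X * Y)) := [seq (- x.1, x.2) | x <- s].

Let tensor_eq_cancel x y : tensor_eq [:: (x, y); (- x, y)] [::].
Proof.
apply: tensor_eq_trans (tensor_eq_sym (tensor_eq_addl x (- x) y)) _.
by rewrite subrr; exact: tensor_eq_0l.
Qed.

Let tensor_eq_oppl s : tensor_eq (opps s ++ s) [::].
Proof.
elim: s => [|[x y] s IHs] /=; first exact: tensor_eq_refl.
apply: (@tensor_eq_trans _ ([:: (x, y); (- x, y)] ++ (opps s ++ s))).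
  have -> : (- x, y) :: opps s ++ (x, y) :: s =
    ((- x, y) :: opps s) ++ ([:: (x, y)] ++ s) by [].
  apply: tensor_eq_trans (tensor_eq_catC _ _) _.
  rewrite -catA; apply: (@tensor_eq_cat [:: (x, y)] [:: (x, y)]).
    exact: tensor_eq_refl.
  exact: (@tensor_eq_catC s ((- x, y) :: opps s)).
exact: (@tensor_eq_cat _ [::] _ [::] (tensor_eq_cancel x y) IHs).
Qed.

Let tensor_eq_opp s t : tensor_eq s t -> tensor_eq (opps s) (opps t).
Proof.
move=> st.
apply: (@tensor_eq_trans _ (opps s ++ (t ++ opps t))).
  rewrite -{1}[opps s]cats0; apply: tensor_eq_cat; first exact: tensor_eq_refl.
  apply: tensor_eq_sym; apply: tensor_eq_trans (tensor_eq_catC _ _) _.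
  exact: tensor_eq_oppl.
rewrite catA -[X in tensor_eq _ X]cat0s; apply: tensor_eq_cat.
  apply: tensor_eq_trans (tensor_eq_oppl s); apply: tensor_eq_cat.
    exact: tensor_eq_refl.
  exact: tensor_eq_sym.
exact: tensor_eq_refl.
Qed.

Definition tensor_add (u v : tensor) : tensor := \pi_tensor (repr u ++ repr v).
Definition tensor_opp (u : tensor) : tensor :=
  \pi_tensor [seq (- x.1, x.2) | x <- repr u].

Lemma pi_tensor_add s t :
  tensor_add (\pi_tensor s) (\pi_tensor t) = \pi_tensor (s ++ t).
Proof.
by apply/tensor_piP; apply: tensor_eq_cat; exact: tensor_eq_repr.
Qed.

Lemma pi_tensor_opp s :
  tensor_opp (\pi_tensor s) = \pi_tensor [seq (- x.1, x.2) | x <- s].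
Proof.
by apply/tensor_piP; apply: tensor_eq_opp; exact: tensor_eq_repr.
Qed.

Let tensor_addA : associative tensor_add.
Proof.
move=> u v w; rewrite -[u]reprK -[v]reprK -[w]reprK.
move: (repr u) (repr v) (repr w) => a b c.
by rewrite (pi_tensor_add b c) (pi_tensor_add a) (pi_tensor_add a b)
  (pi_tensor_add _ c) catA.
Qed.

Let tensor_addC : commutative tensor_add.
Proof. by move=> u v; apply/tensor_piP; exact: tensor_eq_catC. Qed.

Let tensor_add0 : left_id (\pi_tensor [::]) tensor_add.
Proof. by move=> u; rewrite -[u in LHS]reprK pi_tensor_add cat0s reprK. Qed.

Let tensor_addN : left_inverse (\pi_tensor [::]) tensor_opp tensor_add.
Proof.
move=> u; rewrite -[u]reprK; move: (repr u) => s.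
rewrite pi_tensor_opp pi_tensor_add.
by apply/tensor_piP; exact: tensor_eq_oppl.
Qed.

HB.instance Definition _ := GRing.isZmodule.Build tensor
  tensor_addA tensor_addC tensor_add0 tensor_addN.

Definition tens (x : X) (y : Y) : tensor := \pi_tensor [:: (x, y)].

Definition tsum (s : seq (X * Y)) : tensor := \sum_(x <- s) tens x.1 x.2.

Lemma pi_tsum s : \pi_tensor s = tsum s.
Proof.
rewrite /tsum; elim: s => [|[x y] s IHs]; first by rewrite big_nil.
by rewrite big_cons -IHs [RHS]pi_tensor_add.
Qed.

Lemma tsum_surj (u : tensor) : exists s, u = tsum s.
Proof. by exists (repr u); rewrite -pi_tsum reprK. Qed.

Lemma tensDl x x' y : tens (x + x') y = tens x y + tens x' y.
Proof.
rewrite [RHS]pi_tensor_add; apply/tensor_piP; exact: tensor_eq_addl.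
Qed.

Lemma tensDr x y y' : tens x (y + y') = tens x y + tens x y'.
Proof.
rewrite [RHS]pi_tensor_add; apply/tensor_piP; exact: tensor_eq_addr.
Qed.

Lemma tens_bal i x y : tens (ra i x) y = tens x (la i y).
Proof. by apply/tensor_piP; exact: tensor_eq_bal. Qed.

Lemma tensor_ind (P : tensor -> Prop) :
  P 0 -> (forall u v, P u -> P v -> P (u + v)) -> (forall x y, P (tens x y)) ->
  forall u, P u.
Proof.
move=> P0 PD Pt u; have [s ->] := tsum_surj u; rewrite /tsum.
by elim/big_ind: _.
Qed.

Section Lift.
Variable Z : zmodType.

Record balanced (f : X -> Y -> Z) : Prop := Balanced {
  balancedDl : forall x x' y, f (x + x') y = f x y + f x' y;
  balancedDr : forall x y y', f x (y + y') = f x y + f x y';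
  balanced_bal : forall i x y, f (ra i x) y = f x (la i y) }.

(* The map u = \sum_k x_k (x) y_k |-> \sum_k f x_k y_k; it is independent of  *)
(* the representation of u as soon as f is balanced (tlift_tens, tliftD).     *)
Definition tlift (f : X -> Y -> Z) (u : tensor) : Z :=
  \sum_(x <- repr u) f x.1 x.2.

Variable f : X -> Y -> Z.
Hypothesis fP : balanced f.

Let f0 y : f 0 y = 0.
Proof. by apply: (addIr (f 0 y)); rewrite -(balancedDl fP) !add0r. Qed.

Let tensor_eq_lift s t : tensor_eq s t ->
  \sum_(x <- s) f x.1 x.2 = \sum_(x <- t) f x.1 x.2.
Proof.
elim=> {s t} //.
- by move=> s t u _ -> _ ->.
- by move=> s s' t t' _ IHs _ IHt; rewrite !big_cat /= IHs IHt.
- by move=> s t; rewrite !big_cat /= addrC.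
- by move=> x x' y; rewrite !big_cons !big_nil /= !addr0 (balancedDl fP).
- by move=> x y y'; rewrite !big_cons !big_nil /= !addr0 (balancedDr fP).
- by move=> y; rewrite big_cons big_nil /= addr0 f0.
- by move=> i x y; rewrite !big_cons !big_nil /= !addr0 (balanced_bal fP).
Qed.

Lemma tlift_tsum s : tlift f (tsum s) = \sum_(x <- s) f x.1 x.2.
Proof. by rewrite -pi_tsum; apply: tensor_eq_lift; exact: tensor_eq_repr. Qed.

Lemma tlift_tens x y : tlift f (tens x y) = f x y.
Proof.
have -> : tens x y = tsum [:: (x, y)] by rewrite /tsum big_seq1.
by rewrite tlift_tsum big_seq1.
Qed.

Lemma tlift0 : tlift f 0 = 0.
Proof.
have -> : 0 = tsum [::] :> tensor by rewrite /tsum big_nil.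
by rewrite tlift_tsum big_nil.
Qed.

Lemma tliftD u v : tlift f (u + v) = tlift f u + tlift f v.
Proof.
have [[s ->] [t ->]] := (tsum_surj u, tsum_surj v).
by rewrite /tsum -big_cat -/(tsum _) !tlift_tsum big_cat.
Qed.

End Lift.

End Tensor.


(* The enveloping algebra A^e = A (x)_K A^op; A^op is the converse ring A^c.  *)
Section Enveloping.
Variables (K : fieldType) (A : algType K).

Definition env : Type :=
  tensor (fun (k : K) (a : A) => k *: a)
         (fun (k : K) (b : A^c) => k *: (b : A)).

HB.instance Definition _ := GRing.Zmodule.on env.

(* a \overline b *)
Definition envt (a b : A) : env := tens _ _ a (b : A^c).

Lemma envt_ind (P : env -> Prop) :
  P 0 -> (forall u v, P u -> P v -> P (u + v)) -> (forall a b, P (envt a b)) ->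
  forall u, P u.
Proof. exact: tensor_ind. Qed.

Lemma envtDl a a' b : envt (a + a') b = envt a b + envt a' b.
Proof. exact: tensDl. Qed.

Lemma envtDr a b b' : envt a (b + b') = envt a b + envt a b'.
Proof. exact: tensDr. Qed.

Lemma envtZ k a b : envt (k *: a) b = envt a (k *: b).
Proof. exact: tens_bal. Qed.

Definition env_lift (Z : zmodType) (f : A -> A -> Z) (u : env) : Z := tlift f u.

Definition env_balanced (Z : zmodType) (f : A -> A -> Z) : Prop :=
  [/\ forall a a' b, f (a + a') b = f a b + f a' b,
      forall a b b', f a (b + b') = f a b + f a b' &
      forall k a b, f (k *: a) b = f a (k *: b)].

Lemma env_lift_envt (Z : zmodType) (f : A -> A -> Z) a b :
  env_balanced f -> env_lift f (envt a b) = f a b.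
Proof. by case=> *; exact: tlift_tens. Qed.

Lemma env_liftD (Z : zmodType) (f : A -> A -> Z) u v :
  env_balanced f -> env_lift f (u + v) = env_lift f u + env_lift f v.
Proof. by case=> *; exact: tliftD. Qed.

Lemma env_lift0 (Z : zmodType) (f : A -> A -> Z) :
  env_balanced f -> env_lift f 0 = 0.
Proof. by case=> *; exact: tlift0. Qed.

Definition env_one : env := envt 1 1.
Definition env_mul (u v : env) : env :=
  env_lift (fun a b => env_lift (fun a' b' => envt (a * a') (b' * b)) v) u.
Definition env_scale (k : K) (u : env) : env :=
  env_lift (fun a b => envt (k *: a) b) u.

Let mul_bal1 a b : env_balanced (fun a' b' => envt (a * a') (b' * b)).
Proof.
split=> *; rewrite ?mulrDr ?mulrDl ?envtDl ?envtDr //.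
by rewrite -scalerAr envtZ scalerAl.
Qed.

Let mul_bal v :
  env_balanced (fun a b => env_lift (fun a' b' => envt (a * a') (b' * b)) v).
Proof.
elim/envt_ind: v => [|u v [uDl uDr uZ] [vDl vDr vZ]|c d].
- by split=> *; rewrite !env_lift0 ?addr0.
- split=> *; rewrite !env_liftD ?uDl ?uDr ?vDl ?vDr ?uZ ?vZ //.
    by rewrite addrACA.
  by rewrite addrACA.
- split=> *; rewrite !env_lift_envt ?mulrDr ?mulrDl ?envtDl ?envtDr //.
  by rewrite -scalerAl envtZ scalerAr.
Qed.

Lemma env_mulE a b a' b' :
  env_mul (envt a b) (envt a' b') = envt (a * a') (b' * b).
Proof.
by rewrite /env_mul env_lift_envt ?env_lift_envt //; exact: mul_bal.
Qed.

Let mulDl : left_distributive env_mul +%R.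
Proof. by move=> u v w; rewrite /env_mul env_liftD //; exact: mul_bal. Qed.

Let mul0 v : env_mul 0 v = 0.
Proof. by rewrite /env_mul env_lift0 //; exact: mul_bal. Qed.

Let mulDr : right_distributive env_mul +%R.
Proof.
move=> u v w; elim/envt_ind: u => [|u u' IHu IHu'|a b].
- by rewrite !mul0 addr0.
- by rewrite !mulDl IHu IHu' addrACA.
- rewrite /env_mul !env_lift_envt ?env_liftD //; exact: mul_bal.
Qed.

Let mulr0' u : env_mul u 0 = 0.
Proof. by apply: (addIr (env_mul u 0)); rewrite -mulDr !add0r. Qed.

Let mulA : associative env_mul.
Proof.
move=> u v w; elim/envt_ind: u => [|u u' IHu IHu'|a b].
- by rewrite !mul0.
- by rewrite !mulDl IHu IHu'.
elim/envt_ind: v => [|v v' IHv IHv'|c d].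
- by rewrite mul0 mulr0' mul0.
- by rewrite mulDl !mulDr IHv IHv' mulDl.
elim/envt_ind: w => [|w w' IHw IHw'|e f].
- by rewrite !mulr0'.
- by rewrite !mulDr IHw IHw'.
- by rewrite !env_mulE !mulrA.
Qed.

Let mul1 : left_id env_one env_mul.
Proof.
elim/envt_ind=> [|u v IHu IHv|a b]; first by rewrite mulr0'.
  by rewrite mulDr IHu IHv.
by rewrite env_mulE mul1r mulr1.
Qed.

Let mulr1' : right_id env_one env_mul.
Proof.
elim/envt_ind=> [|u v IHu IHv|a b]; first by rewrite mul0.
  by rewrite mulDl IHu IHv.
by rewrite env_mulE mul1r mulr1.
Qed.

Let one_neq0 : env_one != 0.
Proof.
have mB : env_balanced (fun a b : A => a * b).
  by split=> *; rewrite ?mulrDl ?mulrDr // -scalerAl scalerAr.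
apply/eqP=> /(congr1 (env_lift (fun a b => a * b))).
by rewrite env_lift_envt // env_lift0 // mulr1 => /eqP; rewrite oner_eq0.
Qed.

HB.instance Definition _ := GRing.Zmodule_isNzRing.Build env
  mulA mul1 mulr1' mulDl mulDr one_neq0.

Let scale_bal k : env_balanced (fun a b => envt (k *: a) b).
Proof.
split=> *; rewrite ?scalerDr ?envtDl ?envtDr //.
by rewrite scalerA mulrC -scalerA envtZ.
Qed.

Lemma env_scaleE k a b : env_scale k (envt a b) = envt (k *: a) b.
Proof. exact: env_lift_envt. Qed.

Let scaleDr : right_distributive env_scale +%R.
Proof. by move=> k u v; exact: env_liftD. Qed.

Let scale0 k : env_scale k 0 = 0.
Proof. exact: env_lift0. Qed.

Let scaleA k l u : env_scale k (env_scale l u) = env_scale (k * l) u.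
Proof.
elim/envt_ind: u => [|u v IHu IHv|a b]; first by rewrite !scale0.
  by rewrite !scaleDr IHu IHv.
by rewrite !env_scaleE scalerA.
Qed.

Let scale1 : left_id 1 env_scale.
Proof.
elim/envt_ind=> [|u v IHu IHv|a b]; first by rewrite !scale0.
  by rewrite !scaleDr IHu IHv.
by rewrite !env_scaleE scale1r.
Qed.

Let scaleDl u : {morph env_scale^~ u : k l / k + l}.
Proof.
move=> k l; elim/envt_ind: u => [|u v IHu IHv|a b]; rewrite ?scale0 ?addr0 //.
  by rewrite !scaleDr IHu IHv addrACA.
by rewrite !env_scaleE scalerDl envtDl.
Qed.

HB.instance Definition _ := GRing.Zmodule_isLmodule.Build K env
  scaleA scale1 scaleDr scaleDl.

Lemma envtM a b a' b' : envt a b * envt a' b' = envt (a * a') (b' * b).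
Proof. exact: env_mulE. Qed.

Lemma envt_scale k a b : k *: envt a b = envt (k *: a) b.
Proof. exact: env_scaleE. Qed.

Let scaleAl (k : K) (u v : env) : k *: (u * v) = (k *: u) * v.
Proof.
elim/envt_ind: u => [|u u' IHu IHu'|a b].
- by rewrite mul0r !scaler0 mul0r.
- by rewrite mulrDl !scalerDr IHu IHu' mulrDl.
elim/envt_ind: v => [|v v' IHv IHv'|c d].
- by rewrite !mulr0 scaler0.
- by rewrite !mulrDr scalerDr IHv IHv'.
- by rewrite envtM !envt_scale envtM scalerAl.
Qed.

Let scaleAr (k : K) (u v : env) : k *: (u * v) = u * (k *: v).
Proof.
elim/envt_ind: u => [|u u' IHu IHu'|a b].
- by rewrite !mul0r !scaler0.
- by rewrite mulrDl !scalerDr IHu IHu' mulrDl.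
elim/envt_ind: v => [|v v' IHv IHv'|c d].
- by rewrite mulr0 scaler0 mulr0.
- by rewrite mulrDr !scalerDr IHv IHv' mulrDr.
- by rewrite envtM !envt_scale envtM scalerAr.
Qed.

HB.instance Definition _ := GRing.Lmodule_isLalgebra.Build K env scaleAl.
HB.instance Definition _ := GRing.Lalgebra_isAlgebra.Build K env scaleAr.

Definition lt (a : A) : env := envt a 1.
Definition rt (b : A) : env := envt 1 b.

Lemma lt_rt a b : envt a b = lt a * rt b.
Proof. by rewrite envtM mulr1 mulr1. Qed.

Lemma rt_lt a b : envt a b = rt b * lt a.
Proof. by rewrite envtM !mul1r. Qed.

End Enveloping.

(* A-bimodules are left A^e-modules, lmodType (env A). *)
Section Bimodules.
Variables (K : fieldType) (A : algType K).
Local Notation E := (env A).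

Definition abim : Type := A.
HB.instance Definition _ := GRing.Zmodule.on abim.

Definition abim_scale (x : E) (m : abim) : abim :=
  env_lift (fun a b : A => a * (m : A) * b : A) x.

Let abim_bal (m : A) : env_balanced (fun a b : A => a * m * b).
Proof.
by split=> *; rewrite ?mulrDl ?mulrDr // -!scalerAl scalerAr.
Qed.

Lemma abim_scale_envt a b (m : A) : abim_scale (envt a b) m = a * m * b.
Proof. exact: env_lift_envt. Qed.

Let abim_scale0 m : abim_scale 0 m = 0.
Proof. exact: env_lift0. Qed.

Let abim_scaleDl m : {morph abim_scale^~ m : x y / x + y}.
Proof. by move=> x y; exact: env_liftD. Qed.

Let abim_scaleDr : right_distributive abim_scale +%R.
Proof.
move=> x m n; elim/envt_ind: x => [|x y IHx IHy|a b].
- by rewrite !abim_scale0 addr0.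
- by rewrite !abim_scaleDl IHx IHy addrACA.
- by rewrite !abim_scale_envt mulrDr mulrDl.
Qed.

Let abim_scaler0 x : abim_scale x 0 = 0.
Proof. by apply: (addIr (abim_scale x 0)); rewrite -abim_scaleDr !add0r. Qed.

Let abim_scaleA x y m : abim_scale x (abim_scale y m) = abim_scale (x * y) m.
Proof.
elim/envt_ind: x => [|x x' IHx IHx'|a b].
- by rewrite mul0r !abim_scale0.
- by rewrite mulrDl !abim_scaleDl IHx IHx'.
elim/envt_ind: y => [|y y' IHy IHy'|c d].
- by rewrite mulr0 !abim_scale0 abim_scaler0.
- by rewrite mulrDr !abim_scaleDl abim_scaleDr IHy IHy'.
- by rewrite envtM !abim_scale_envt !mulrA.
Qed.

Let abim_scale1 : left_id 1 abim_scale.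
Proof. by move=> m; rewrite abim_scale_envt mul1r mulr1. Qed.

HB.instance Definition _ := GRing.Zmodule_isLmodule.Build E abim
  abim_scaleA abim_scale1 abim_scaleDr abim_scaleDl.

Lemma abim_ltE (a : A) (m : abim) : lt a *: m = (a * (m : A) : A).
Proof. by rewrite [LHS]abim_scale_envt mulr1. Qed.
Lemma abim_rtE (a : A) (m : abim) : rt a *: m = ((m : A) * a : A).
Proof. by rewrite [LHS]abim_scale_envt mul1r. Qed.
Lemma rt_ltC (a b : A) : rt a * lt b = lt b * rt a :> E.
Proof. by rewrite -lt_rt -rt_lt. Qed.
Lemma ltD (a b : A) : lt (a + b) = lt a + lt b. Proof. exact: envtDl. Qed.
Lemma rtD (a b : A) : rt (a + b) = rt a + rt b. Proof. exact: envtDr. Qed.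
Lemma ltM (a b : A) : lt (a * b) = lt a * lt b.
Proof. by rewrite envtM mulr1. Qed.
Lemma rtM (a b : A) : rt (a * b) = rt b * rt a.
Proof. by rewrite envtM mulr1. Qed.
Lemma lt1 : lt (1 : A) = 1. Proof. by []. Qed.
Lemma rt1 : rt (1 : A) = 1. Proof. by []. Qed.
Lemma lt_alg (k : K) : lt (k%:A : A) = rt k%:A.
Proof. by rewrite [LHS]envtZ. Qed.
Lemma ltZ (k : K) (a : A) : lt (k *: a) = lt a * lt k%:A.
Proof. by rewrite -ltM -scalerAr mulr1. Qed.
Lemma rtZ (k : K) (a : A) : rt (k *: a) = rt k%:A * rt a.
Proof. by rewrite -rtM -scalerAr mulr1. Qed.

(* M (x)_A N, where A acts on M from the right through \overline a and on N   *)
(* from the left through a; its outer structure is a(m (x) n)b = am (x) nb.   *)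
Section BimTensor.
Variables M N : lmodType E.

Definition bimtens : Type :=
  tensor (fun (a : A) (m : M) => rt a *: m) (fun (a : A) (n : N) => lt a *: n).

HB.instance Definition _ := GRing.Zmodule.on bimtens.

Definition bten (m : M) (n : N) : bimtens := tens _ _ m n.
Definition bsum (s : seq (M * N)) : bimtens := \sum_(x <- s) bten x.1 x.2.

Lemma bsum_surj (t : bimtens) : exists s, t = bsum s.
Proof. exact: tsum_surj. Qed.

Lemma bten_ind (P : bimtens -> Prop) :
  P 0 -> (forall u v, P u -> P v -> P (u + v)) -> (forall m n, P (bten m n)) ->
  forall u, P u.
Proof. exact: tensor_ind. Qed.

Lemma btenDl m m' n : bten (m + m') n = bten m n + bten m' n.
Proof. exact: tensDl. Qed.

Lemma btenDr m n n' : bten m (n + n') = bten m n + bten m n'.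
Proof. exact: tensDr. Qed.

Lemma bten_bal a m n : bten (rt a *: m) n = bten m (lt a *: n).
Proof. exact: tens_bal. Qed.

Definition bim_lift (Z : zmodType) (f : M -> N -> Z) (t : bimtens) : Z :=
  tlift f t.

Definition bim_balanced (Z : zmodType) (f : M -> N -> Z) : Prop :=
  [/\ forall m m' n, f (m + m') n = f m n + f m' n,
      forall m n n', f m (n + n') = f m n + f m n' &
      forall a m n, f (rt a *: m) n = f m (lt a *: n)].

Lemma bim_lift_bten (Z : zmodType) (f : M -> N -> Z) m n :
  bim_balanced f -> bim_lift f (bten m n) = f m n.
Proof. by case=> *; exact: tlift_tens. Qed.

Lemma bim_liftD (Z : zmodType) (f : M -> N -> Z) u v :
  bim_balanced f -> bim_lift f (u + v) = bim_lift f u + bim_lift f v.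
Proof. by case=> *; exact: tliftD. Qed.

Lemma bim_lift0 (Z : zmodType) (f : M -> N -> Z) :
  bim_balanced f -> bim_lift f 0 = 0.
Proof. by case=> *; exact: tlift0. Qed.

Lemma bim_lift_bsum (Z : zmodType) (f : M -> N -> Z) s :
  bim_balanced f -> bim_lift f (bsum s) = \sum_(x <- s) f x.1 x.2.
Proof. by case=> *; exact: tlift_tsum. Qed.

Definition bimtens_scale (x : E) (t : bimtens) : bimtens :=
  env_lift
    (fun a b => bim_lift (fun m n => bten (lt a *: m) (rt b *: n)) t) x.

Let in_bal a b : bim_balanced (fun m n => bten (lt a *: m) (rt b *: n)).
Proof.
split=> *; rewrite ?scalerDr ?btenDl ?btenDr //.
by rewrite scalerA -rt_ltC -scalerA bten_bal !scalerA rt_ltC.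
Qed.

Let out_bal t : env_balanced
  (fun a b => bim_lift (fun m n => bten (lt a *: m) (rt b *: n)) t).
Proof.
elim/bten_ind: t => [|u v [uDl uDr uZ] [vDl vDr vZ]|m n].
- by split=> *; rewrite !bim_lift0 ?addr0.
- split=> *; rewrite !bim_liftD ?uDl ?uDr ?vDl ?vDr ?uZ ?vZ //.
    by rewrite addrACA.
  by rewrite addrACA.
- split=> [a a' b|a b b'|k a b].
  + by rewrite !bim_lift_bten // ltD scalerDl btenDl.
  + by rewrite !bim_lift_bten // rtD scalerDl btenDr.
  + rewrite !bim_lift_bten // ltZ rtZ lt_alg -rt_ltC -!scalerA bten_bal.
    by rewrite lt_alg.
Qed.

Lemma bimtens_scale_bten a b m n :
  bimtens_scale (envt a b) (bten m n) = bten (lt a *: m) (rt b *: n).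
Proof. by rewrite /bimtens_scale env_lift_envt // bim_lift_bten. Qed.

Let bscale0 t : bimtens_scale 0 t = 0.
Proof. exact: env_lift0. Qed.

Let bscaleDl t : {morph bimtens_scale^~ t : x y / x + y}.
Proof. by move=> x y; exact: env_liftD. Qed.

Let bscaleDr : right_distributive bimtens_scale +%R.
Proof.
move=> x t u; elim/envt_ind: x => [|x y IHx IHy|a b].
- by rewrite !bscale0 addr0.
- by rewrite !bscaleDl IHx IHy addrACA.
- by rewrite /bimtens_scale !env_lift_envt // bim_liftD.
Qed.

Let bscaler0 x : bimtens_scale x 0 = 0.
Proof. by apply: (addIr (bimtens_scale x 0)); rewrite -bscaleDr !add0r. Qed.

Let bscaleA x y t :
  bimtens_scale x (bimtens_scale y t) = bimtens_scale (x * y) t.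
Proof.
elim/bten_ind: t => [|t u IHt IHu|m n].
- by rewrite !bscaler0.
- by rewrite !bscaleDr IHt IHu.
elim/envt_ind: x => [|x x' IHx IHx'|a b].
- by rewrite mul0r !bscale0.
- by rewrite mulrDl !bscaleDl IHx IHx'.
elim/envt_ind: y => [|y y' IHy IHy'|c d].
- by rewrite mulr0 !bscale0 bscaler0.
- by rewrite mulrDr !bscaleDl bscaleDr IHy IHy'.
- by rewrite envtM !bimtens_scale_bten !scalerA -ltM -rtM.
Qed.

Let bscale1 : left_id 1 bimtens_scale.
Proof.
elim/bten_ind=> [|t u IHt IHu|m n]; first by rewrite bscaler0.
  by rewrite bscaleDr IHt IHu.
by rewrite bimtens_scale_bten !scale1r.
Qed.

HB.instance Definition _ := GRing.Zmodule_isLmodule.Build E bimtens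
  bscaleA bscale1 bscaleDr bscaleDl.

Lemma bten_scale a b m n :
  envt a b *: bten m n = bten (lt a *: m) (rt b *: n).
Proof. exact: bimtens_scale_bten. Qed.

End BimTensor.

Section BimMaps.
Variables M N P M' N' : lmodType E.

Definition bim_map (f : {linear M -> M'}) (g : {linear N -> N'}) :
    bimtens M N -> bimtens M' N' :=
  bim_lift (fun m n => bten (f m) (g n)).

Lemma bim_map_balanced (f : {linear M -> M'}) (g : {linear N -> N'}) :
  bim_balanced (fun m n => bten (f m) (g n)).
Proof.
split=> *; rewrite ?linearD ?btenDl ?btenDr //.
by rewrite !linearZ bten_bal.
Qed.

Lemma bim_mapE (f : {linear M -> M'}) (g : {linear N -> N'}) m n :
  bim_map f g (bten m n) = bten (f m) (g n).
Proof. exact: bim_lift_bten (bim_map_balanced f g). Qed.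

Definition bim_assoc : bimtens (bimtens M N) P -> bimtens M (bimtens N P) :=
  bim_lift (fun t p => bim_lift (fun m n => bten m (bten n p)) t).

Lemma bim_assoc_balanced_in p :
  bim_balanced (fun (m : M) (n : N) => bten m (bten n p : bimtens N P)).
Proof.
split=> *; rewrite ?btenDl ?btenDr // bten_bal -[lt _]/(envt _ 1) bten_scale.
by rewrite rt1 scale1r.
Qed.

Lemma bim_assoc_balanced : bim_balanced
  (fun (t : bimtens M N) (p : P) => bim_lift (fun m n => bten m (bten n p)) t).
Proof.
have B := bim_assoc_balanced_in.
split=> [t t' p|t p p'|a t p]; first exact: bim_liftD.
  elim/bten_ind: t => [|u v IHu IHv|m n].
  - by rewrite !bim_lift0 ?addr0.
  - by rewrite !bim_liftD // IHu IHv addrACA.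
  - by rewrite !bim_lift_bten // !btenDr.
elim/bten_ind: t => [|u v IHu IHv|m n].
- by rewrite scaler0 !bim_lift0.
- by rewrite scalerDr !bim_liftD // IHu IHv.
- rewrite -[rt a]/(envt 1 a) bten_scale !bim_lift_bten // lt1 scale1r.
  by rewrite bten_bal.
Qed.

Lemma bim_assocE m n p : bim_assoc (bten (bten m n) p) = bten m (bten n p).
Proof.
rewrite /bim_assoc (bim_lift_bten _ _ bim_assoc_balanced).
exact: bim_lift_bten (bim_assoc_balanced_in p).
Qed.

Definition bim_lunit : bimtens abim M -> M :=
  bim_lift (fun (a : abim) (m : M) => lt (a : A) *: m).

Lemma bim_lunit_balanced :
  bim_balanced (fun (a : abim) (m : M) => lt (a : A) *: m).
Proof.
split=> *; rewrite ?ltD ?scalerDl ?scalerDr //.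
by rewrite abim_rtE ltM scalerA.
Qed.

Lemma bim_lunitE (a : A) m : bim_lunit (bten (a : abim) m) = lt a *: m.
Proof. exact: bim_lift_bten bim_lunit_balanced. Qed.

Definition bim_runit : bimtens M abim -> M :=
  bim_lift (fun (m : M) (a : abim) => rt (a : A) *: m).

Lemma bim_runit_balanced :
  bim_balanced (fun (m : M) (a : abim) => rt (a : A) *: m).
Proof.
split=> *; rewrite ?rtD ?scalerDl ?scalerDr //.
by rewrite abim_ltE rtM scalerA.
Qed.

Lemma bim_runitE m (a : A) : bim_runit (bten m (a : abim)) = rt a *: m.
Proof. exact: bim_lift_bten bim_runit_balanced. Qed.

End BimMaps.

Record comonoid (C : lmodType E) := Comonoid {
  comul : {linear C -> bimtens C C};
  counit : {linear C -> abim};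
  comulA : forall c,
    bim_assoc (bim_map comul idfun (comul c)) = bim_map idfun comul (comul c);
  counitl : forall c, bim_lunit (bim_map counit idfun (comul c)) = c;
  counitr : forall c, bim_runit (bim_map idfun counit (comul c)) = c }.

End Bimodules.

(* Restriction of scalars along eta : A^e -> H. *)
Definition restr (K : fieldType) (A H : algType K)
  (eta : {lrmorphism env A -> H}) (M : lmodType H) : Type := M.

Section Restr.
Variables (K : fieldType) (A H : algType K) (eta : {lrmorphism env A -> H}).
Variable M : lmodType H.
Local Notation rM := (restr eta M).

HB.instance Definition _ := GRing.Zmodule.on rM.

Definition restr_scale (x : env A) (m : rM) : rM := eta x *: (m : M).

Let restr_scaleA x y m :
  restr_scale x (restr_scale y m) = restr_scale (x * y) m.
Proof. by rewrite /restr_scale scalerA -rmorphM. Qed.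

Let restr_scale1 : left_id 1 restr_scale.
Proof. by move=> m; rewrite /restr_scale rmorph1 scale1r. Qed.

Let restr_scaleDr : right_distributive restr_scale +%R.
Proof. by move=> x m n; exact: scalerDr. Qed.

Let restr_scaleDl m : {morph restr_scale^~ m : x y / x + y}.
Proof. by move=> x y; rewrite /restr_scale rmorphD scalerDl. Qed.

HB.instance Definition _ := GRing.Zmodule_isLmodule.Build (env A) rM
  restr_scaleA restr_scale1 restr_scaleDr restr_scaleDl.

Lemma restrZ x (m : M) : x *: (m : rM) = (eta x *: m : M).
Proof. by []. Qed.

End Restr.

(* restr eta H^o is |H; the elements h (x)_A h' of |H (x)_A |H, and finite    *)
(* sums of them.                                                              *)
Section RegularTensor.
Variables (K : fieldType) (A H : algType K) (eta : {lrmorphism env A -> H}).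

Definition regten (h h' : H) : bimtens (restr eta H^o) (restr eta H^o) :=
  bten (h : restr eta H^o) (h' : restr eta H^o).

Definition regsum (u : seq (H * H)) : bimtens (restr eta H^o) (restr eta H^o) :=
  \sum_(x <- u) regten x.1 x.2.

Lemma regsum_surj t : exists u, t = regsum u.
Proof. exact: (@bsum_surj _ _ (restr eta H^o) (restr eta H^o) t). Qed.

End RegularTensor.

(* Sweedler expressions are stated for every representation                   *)
(* \sum_k x_k (x) y_k of the tensor at hand. In comulM this says that         *)
(* h_(1)h'_(1) (x)_A h_(2)h'_(2) is well defined, which contains the Takeuchi *)
(* condition (see takeuchi below).                                            *)
Record left_bialgebroid (K : fieldType) (A H : algType K) := LeftBialgebroid {
  eta : {lrmorphism env A -> H};
  bgd_comonoid : comonoid (restr eta H^o);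
  comul_mulr : forall (h : H) (r s : A) (u : seq (H * H)),
    comul bgd_comonoid h = regsum eta u ->
    comul bgd_comonoid (h * eta (envt r s)) =
      regsum eta [seq (x.1 * eta (lt r), x.2 * eta (rt s)) | x <- u];
  counit_mulr : forall (h : H) (r : A),
    counit bgd_comonoid (h * eta (lt r)) = counit bgd_comonoid (h * eta (rt r));
  comulM : forall (h h' : H) (u v : seq (H * H)),
    comul bgd_comonoid h = regsum eta u ->
    comul bgd_comonoid h' = regsum eta v ->
    comul bgd_comonoid (h * h') =
      regsum eta [seq (x.1 * y.1, x.2 * y.2) | x <- u, y <- v];
  comul1 : comul bgd_comonoid (1 : H) = regten eta 1 1;
  counit1 : counit bgd_comonoid (1 : H) = (1 : A);
  counitM_lt : forall h h' : H, counit bgd_comonoid (h * h') =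
    counit bgd_comonoid (h * eta (lt (counit bgd_comonoid h' : A)));
  counitM_rt : forall h h' : H, counit bgd_comonoid (h * h') =
    counit bgd_comonoid (h * eta (rt (counit bgd_comonoid h' : A))) }.

Section Bialgebroid.
Variables (K : fieldType) (A H : algType K) (B : left_bialgebroid A H).

(* The elements a and \overline a of H. *)
Definition src (a : A) : H := eta B (lt a).
Definition tgt (a : A) : H := eta B (rt a).
Definition Delta (h : H) : bimtens (restr (eta B) H^o) (restr (eta B) H^o) :=
  comul (bgd_comonoid B) h.
Definition eps (h : H) : A := counit (bgd_comonoid B) h.

Lemma regten_bal a h h' :
  regten (eta B) (tgt a * h) h' = regten (eta B) h (src a * h').
Proof. exact: (@bten_bal _ _ (restr (eta B) H^o) (restr (eta B) H^o)). Qed.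

Lemma regtenDl h1 h2 h' :
  regten (eta B) (h1 + h2) h' = regten (eta B) h1 h' + regten (eta B) h2 h'.
Proof. exact: (@btenDl _ _ (restr (eta B) H^o) (restr (eta B) H^o)). Qed.

Lemma regtenDr h h1 h2 :
  regten (eta B) h (h1 + h2) = regten (eta B) h h1 + regten (eta B) h h2.
Proof. exact: (@btenDr _ _ (restr (eta B) H^o) (restr (eta B) H^o)). Qed.

Lemma regten0 h' : regten (eta B) 0 h' = 0.
Proof. by apply: (addIr (regten (eta B) 0 h')); rewrite -regtenDl !add0r. Qed.

Lemma takeuchi h a u : Delta h = regsum (eta B) u ->
  regsum (eta B) [seq (x.1 * tgt a, x.2) | x <- u] =
  regsum (eta B) [seq (x.1, x.2 * src a) | x <- u].
Proof.
move=> hu; set T := regten (eta B).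
have D1 : Delta 1 = regsum (eta B) [:: (1, 1)].
  by rewrite /regsum big_seq1; exact: comul1.
have D2 : Delta 1 = regsum (eta B) [:: (1, 1); (tgt a, 1); (- 1, src a)].
  rewrite D1 /regsum !big_cons !big_nil /= !addr0.
  have := regten_bal a 1 1; rewrite !mulr1 => ->.
  by rewrite -regtenDl subrr regten0 addr0.
have := comulM hu D1; rewrite (comulM hu D2) /regsum.
rewrite !big_allpairs_dep /= => /eqP.
under eq_bigr do rewrite !big_cons !big_nil /= !mulr1 mulrN1 addr0.
under [X in _ == X]eq_bigr do rewrite big_seq1 /= !mulr1.
rewrite big_split /= -subr_eq0 addrAC subrr add0r big_split /= addr_eq0.
move=> /eqP E.
rewrite !big_map /= E -sumrN; apply: eq_bigr => x _; apply/eqP.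
by rewrite eq_sym -addr_eq0 -/T -regtenDl subrr regten0.
Qed.

Lemma Delta_D h h' : Delta (h + h') = Delta h + Delta h'.
Proof. exact: linearD. Qed.

Lemma eps_lt a h : eps (src a * h) = a * eps h.
Proof.
rewrite -[RHS]abim_ltE.
exact: (linearZZ (counit (bgd_comonoid B)) (lt a) (h : restr (eta B) H^o)).
Qed.

(* The unit object A, with h |> a = epsilon(h a). *)
Definition hunit : Type := A.
HB.instance Definition _ := GRing.Zmodule.on hunit.

Definition hunit_scale (h : H) (a : hunit) : hunit := eps (h * src (a : A)).

Let hunit_scaleA h h' a :
  hunit_scale h (hunit_scale h' a) = hunit_scale (h * h') a.
Proof. by rewrite /hunit_scale -mulrA; apply/esym; exact: counitM_lt. Qed.

Let hunit_scale1 : left_id 1 hunit_scale.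
Proof.
move=> a; rewrite /hunit_scale mul1r -[src a]mulr1 eps_lt.
by rewrite [eps 1]counit1 mulr1.
Qed.

Let hunit_scaleDr : right_distributive hunit_scale +%R.
Proof.
move=> h a b; rewrite /hunit_scale /src ltD rmorphD mulrDr.
exact: (linearD (counit (bgd_comonoid B))).
Qed.

Let hunit_scaleDl a : {morph hunit_scale^~ a : h h' / h + h'}.
Proof.
move=> h h'; rewrite /hunit_scale mulrDl.
exact: (linearD (counit (bgd_comonoid B))).
Qed.

HB.instance Definition _ := GRing.Zmodule_isLmodule.Build H hunit
  hunit_scaleA hunit_scale1 hunit_scaleDr hunit_scaleDl.

(* M (x)_A N for H-modules, with h |> (m (x) n) = h_(1) m (x) h_(2) n. *)
Section HTensor.
Variables M N : lmodType H.

Definition htens : Type := bimtens (restr (eta B) M) (restr (eta B) N).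
HB.instance Definition _ := GRing.Zmodule.on htens.

Definition hten (m : M) (n : N) : htens :=
  bten (m : restr (eta B) M) (n : restr (eta B) N).

Lemma hten_ind (P : htens -> Prop) :
  P 0 -> (forall u v, P u -> P v -> P (u + v)) -> (forall m n, P (hten m n)) ->
  forall u, P u.
Proof. exact: bten_ind. Qed.

Lemma htenDl m m' n : hten (m + m') n = hten m n + hten m' n.
Proof. exact: btenDl. Qed.

Lemma htenDr m n n' : hten m (n + n') = hten m n + hten m n'.
Proof. exact: btenDr. Qed.

Lemma hten_bal a m n : hten (tgt a *: m) n = hten m (src a *: n).
Proof. exact: (@bten_bal _ _ (restr (eta B) M) (restr (eta B) N)). Qed.

Definition hlift (Z : zmodType) (f : M -> N -> Z) (t : htens) : Z :=
  @bim_lift _ _ (restr (eta B) M) (restr (eta B) N) Z f t.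

Definition h_balanced (Z : zmodType) (f : M -> N -> Z) : Prop :=
  [/\ forall m m' n, f (m + m') n = f m n + f m' n,
      forall m n n', f m (n + n') = f m n + f m n' &
      forall a m n, f (tgt a *: m) n = f m (src a *: n)].

Lemma hlift_hten (Z : zmodType) (f : M -> N -> Z) m n :
  h_balanced f -> hlift f (hten m n) = f m n.
Proof.
exact: (@bim_lift_bten _ _ (restr (eta B) M) (restr (eta B) N) Z f m n).
Qed.

Lemma hliftD (Z : zmodType) (f : M -> N -> Z) u v :
  h_balanced f -> hlift f (u + v) = hlift f u + hlift f v.
Proof.
exact: (@bim_liftD _ _ (restr (eta B) M) (restr (eta B) N) Z f u v).
Qed.

Lemma hlift0 (Z : zmodType) (f : M -> N -> Z) :
  h_balanced f -> hlift f 0 = 0.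
Proof. exact: (@bim_lift0 _ _ (restr (eta B) M) (restr (eta B) N) Z f). Qed.

Definition hact (m : M) (n : N)
    (d : bimtens (restr (eta B) H^o) (restr (eta B) H^o)) : htens :=
  @bim_lift _ _ (restr (eta B) H^o) (restr (eta B) H^o) htens
    (fun h1 h2 : H => hten (h1 *: m) (h2 *: n)) d.

Definition htens_scale (h : H) (t : htens) : htens :=
  hlift (fun m n => hact m n (Delta h)) t.

Let act_bal m n : bim_balanced
  (fun h1 h2 : restr (eta B) H^o => hten ((h1 : H) *: m) ((h2 : H) *: n)).
Proof.
split=> [h1 h2 h|h h1 h2|a h1 h2].
- by rewrite [((h1 : H) + h2) *: m]scalerDl htenDl.
- by rewrite [((h1 : H) + h2) *: n]scalerDl htenDr.
- rewrite -[rt a *: h1]/(tgt a * h1 : H) -[lt a *: h2]/(src a * h2 : H).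
  by rewrite -!scalerA hten_bal.
Qed.

Lemma hact_regsum m n u :
  hact m n (regsum (eta B) u) = \sum_(x <- u) hten (x.1 *: m) (x.2 *: n).
Proof. exact: (bim_lift_bsum _ (act_bal m n)). Qed.

Let hact_bal h : h_balanced (fun m n => hact m n (Delta h)).
Proof.
have [u hu] := regsum_surj (Delta h); rewrite hu.
split=> [m m' n|m n n'|a m n]; rewrite !hact_regsum.
- by rewrite -big_split; apply: eq_bigr => x _; rewrite scalerDr htenDl.
- by rewrite -big_split; apply: eq_bigr => x _; rewrite scalerDr htenDr.
have := congr1 (hact m n) (takeuchi a hu); rewrite !hact_regsum !big_map /=.
by under eq_bigr do rewrite -scalerA; under [RHS]eq_bigr do rewrite -scalerA.
Qed.

Lemma htens_scaleE h m n u : Delta h = regsum (eta B) u ->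
  htens_scale h (hten m n) = \sum_(x <- u) hten (x.1 *: m) (x.2 *: n).
Proof. by move=> hu; rewrite /htens_scale hlift_hten // hu hact_regsum. Qed.

Let hscale0 h : htens_scale h 0 = 0.
Proof. exact: hlift0. Qed.

Let hscaleDr : right_distributive htens_scale +%R.
Proof. by move=> h t t'; exact: hliftD. Qed.

Let hscale_sum h (u : seq (H * H)) (F : H * H -> htens) :
  htens_scale h (\sum_(x <- u) F x) = \sum_(x <- u) htens_scale h (F x).
Proof.
by elim/big_rec2: _ => [|x y z _ <-]; rewrite ?hscale0 ?hscaleDr.
Qed.

Let hscaleA h h' t : htens_scale h (htens_scale h' t) = htens_scale (h * h') t.
Proof.
elim/hten_ind: t => [|t t' IHt IHt'|m n].
- by rewrite !hscale0.
- by rewrite !hscaleDr IHt IHt'.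
have [[u hu] [v hv]] := (regsum_surj (Delta h), regsum_surj (Delta h')).
rewrite (htens_scaleE _ _ hv) hscale_sum (htens_scaleE _ _ (comulM hu hv)).
under eq_bigr do rewrite (htens_scaleE _ _ hu).
rewrite exchange_big big_allpairs_dep /=.
by apply: eq_bigr => x _; apply: eq_bigr => y _; rewrite !scalerA.
Qed.

Let hscale1 : left_id 1 htens_scale.
Proof.
elim/hten_ind => [|t t' IHt IHt'|m n]; first exact: hscale0.
  by rewrite hscaleDr IHt IHt'.
have D1 : Delta 1 = regsum (eta B) [:: (1, 1)].
  by rewrite /regsum big_seq1; exact: comul1.
by rewrite (htens_scaleE _ _ D1) big_seq1 /= !scale1r.
Qed.

Let hscaleDl t : {morph htens_scale^~ t : h h' / h + h'}.
Proof.
move=> h h'; elim/hten_ind: t => [|t t' IHt IHt'|m n].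
- by rewrite !hscale0 addr0.
- by rewrite !hscaleDr IHt IHt' addrACA.
rewrite /htens_scale !hlift_hten // Delta_D.
exact: bim_liftD (act_bal m n).
Qed.

HB.instance Definition _ := GRing.Zmodule_isLmodule.Build H htens
  hscaleA hscale1 hscaleDr hscaleDl.

Lemma htensZ h m n u : Delta h = regsum (eta B) u ->
  h *: hten m n = \sum_(x <- u) hten (x.1 *: m) (x.2 *: n).
Proof. exact: htens_scaleE. Qed.

End HTensor.

(* The structure of the monoidal category of left H-modules, with unit hunit. *)
Section Monoidal.
Variables M N P M' N' : lmodType H.

Definition hmap (f : {linear M -> M'}) (g : {linear N -> N'}) :
    htens M N -> htens M' N' :=
  hlift (fun m n => hten (f m) (g n)).

Lemma hmap_balanced (f : {linear M -> M'}) (g : {linear N -> N'}) :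
  h_balanced (fun m n => hten (f m) (g n)).
Proof.
split=> *; rewrite ?linearD ?htenDl ?htenDr //.
by rewrite !linearZ hten_bal.
Qed.

Lemma hmapE (f : {linear M -> M'}) (g : {linear N -> N'}) m n :
  hmap f g (hten m n) = hten (f m) (g n).
Proof. exact: hlift_hten (hmap_balanced f g). Qed.

Lemma Delta_src a : Delta (src a) = regsum (eta B) [:: (src a, 1)].
Proof.
have D1 : Delta 1 = regsum (eta B) [:: (1, 1)].
  by rewrite /regsum big_seq1; exact: comul1.
by have := comul_mulr a 1 D1; rewrite /= !mul1r rt1 rmorph1.
Qed.

Lemma Delta_tgt a : Delta (tgt a) = regsum (eta B) [:: (1, tgt a)].
Proof.
have D1 : Delta 1 = regsum (eta B) [:: (1, 1)].
  by rewrite /regsum big_seq1; exact: comul1.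
by have := comul_mulr 1 a D1; rewrite /= !mul1r lt1 rmorph1.
Qed.

Lemma hten_srcZ a (m : M) (n : N) : src a *: hten m n = hten (src a *: m) n.
Proof. by rewrite (htensZ _ _ (Delta_src a)) big_seq1 /= scale1r. Qed.

Lemma hten_tgtZ a (m : M) (n : N) : tgt a *: hten m n = hten m (tgt a *: n).
Proof. by rewrite (htensZ _ _ (Delta_tgt a)) big_seq1 /= scale1r. Qed.

End Monoidal.

Section Associator.
Variables M N P : lmodType H.

Definition hassoc : htens (htens M N) P -> htens M (htens N P) :=
  hlift (fun t p => hlift (fun m n => hten m (hten n p)) t).

Lemma hassoc_balanced_in p :
  h_balanced (fun (m : M) (n : N) => hten m (hten n p : htens N P)).
Proof. by split=> *; rewrite ?htenDl ?htenDr // hten_bal hten_srcZ. Qed.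

Lemma hassoc_balanced : h_balanced
  (fun (t : htens M N) (p : P) => hlift (fun m n => hten m (hten n p)) t).
Proof.
have bal := hassoc_balanced_in.
split=> [t t' p|t p p'|a t p]; first exact: hliftD.
  elim/hten_ind: t => [|u v IHu IHv|m n].
  - by rewrite !hlift0 ?addr0.
  - by rewrite !hliftD // IHu IHv addrACA.
  - by rewrite !hlift_hten // !htenDr.
elim/hten_ind: t => [|u v IHu IHv|m n].
- by rewrite scaler0 !hlift0.
- by rewrite scalerDr !hliftD // IHu IHv.
- by rewrite hten_tgtZ !hlift_hten // hten_bal.
Qed.

Lemma hassocE m n p : hassoc (hten (hten m n) p) = hten m (hten n p).
Proof.
rewrite /hassoc (hlift_hten _ _ hassoc_balanced).
exact: hlift_hten (hassoc_balanced_in p).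
Qed.

Definition hassocV : htens M (htens N P) -> htens (htens M N) P :=
  hlift (fun m t => hlift (fun n p => hten (hten m n) p) t).

Lemma hassocV_balanced_in m :
  h_balanced (fun (n : N) (p : P) => hten (hten m n : htens M N) p).
Proof. by split=> *; rewrite ?htenDr ?htenDl // -hten_tgtZ hten_bal. Qed.

Lemma hassocV_balanced : h_balanced
  (fun (m : M) (t : htens N P) => hlift (fun n p => hten (hten m n) p) t).
Proof.
have bal := hassocV_balanced_in.
split=> [m m' t|m t t'|a m t]; last 1 first.
- elim/hten_ind: t => [|u v IHu IHv|n p].
  + by rewrite scaler0 !hlift0.
  + by rewrite scalerDr !hliftD // IHu IHv.
  + by rewrite hten_srcZ !hlift_hten // hten_bal.
- elim/hten_ind: t => [|u v IHu IHv|n p].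
  + by rewrite !hlift0 ?addr0.
  + by rewrite !hliftD // IHu IHv addrACA.
  + by rewrite !hlift_hten // !htenDl.
- exact: hliftD.
Qed.

Lemma hassocVE m n p : hassocV (hten m (hten n p)) = hten (hten m n) p.
Proof.
rewrite /hassocV (hlift_hten _ _ hassocV_balanced).
exact: hlift_hten (hassocV_balanced_in m).
Qed.

End Associator.

Section Unitors.
Variable M : lmodType H.

Lemma hunit_srcE a (b : hunit) : src a *: b = (a * (b : A) : A).
Proof.
rewrite [LHS]eps_lt; congr (_ * _); rewrite -[src _]mulr1 eps_lt.
by rewrite [eps 1]counit1 mulr1.
Qed.

Lemma hunit_tgtE a (b : hunit) : tgt a *: b = ((b : A) * a : A).
Proof.
rewrite -[LHS]/(eps (tgt a * src (b : A))) /tgt /src -rmorphM rt_ltC rmorphM.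
rewrite eps_lt; congr (_ * _).
have := @counit_mulr _ _ _ B 1 a; rewrite !mul1r => /esym E.
rewrite [LHS]E -[eta B (lt a)]mulr1 -[LHS]/(eps (src a * 1)) eps_lt.
by rewrite [eps 1]counit1 mulr1.
Qed.

Definition hlunit : htens hunit M -> M :=
  hlift (fun (a : hunit) (m : M) => src (a : A) *: m).

Lemma hlunit_balanced :
  h_balanced (fun (a : hunit) (m : M) => src (a : A) *: m).
Proof.
split=> *; rewrite ?scalerDr //.
  by rewrite /src ltD rmorphD scalerDl.
by rewrite hunit_tgtE /src ltM rmorphM scalerA.
Qed.

Lemma hlunitE (a : A) m : hlunit (hten (a : hunit) m) = src a *: m.
Proof. exact: hlift_hten hlunit_balanced. Qed.

Definition hrunit : htens M hunit -> M :=
  hlift (fun (m : M) (a : hunit) => tgt (a : A) *: m).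

Lemma hrunit_balanced :
  h_balanced (fun (m : M) (a : hunit) => tgt (a : A) *: m).
Proof.
split=> *; rewrite ?scalerDr //.
  by rewrite /tgt rtD rmorphD scalerDl.
by rewrite hunit_srcE /tgt rtM rmorphM scalerA.
Qed.

Lemma hrunitE m (a : A) : hrunit (hten m (a : hunit)) = tgt a *: m.
Proof. exact: hlift_hten hrunit_balanced. Qed.

End Unitors.

Record hcoalgebra (C : lmodType H) := HCoalgebra {
  hcomul : {linear C -> htens C C};
  hcounit : {linear C -> hunit};
  hcomulA : forall c,
    hassoc (hmap hcomul idfun (hcomul c)) = hmap idfun hcomul (hcomul c);
  hcounitl : forall c, hlunit (hmap hcounit idfun (hcomul c)) = c;
  hcounitr : forall c, hrunit (hmap idfun hcounit (hcomul c)) = c }.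

(* The associators and unitors are implicit in the usual formulation. *)
Record lax_braiding (C : lmodType H) (Q : hcoalgebra C) := LaxBraiding {
  tau :> forall M : lmodType H, {linear htens C M -> htens M C};
  tau_natural : forall (M N : lmodType H) (f : {linear M -> N}) (t : htens C M),
    tau N (hmap idfun f t) = hmap f idfun (tau M t);
  tau_tensor : forall (M N : lmodType H) (t : htens (htens C M) N),
    hassoc (tau (htens M N) (hassoc t)) =
    hmap idfun (tau N) (hassoc (hmap (tau M) idfun t));
  tau_unit : forall t : htens C hunit, hlunit (tau hunit t) = hrunit t;
  tau_comul : forall (M : lmodType H) (t : htens C M),
    hassoc (hmap (tau M) idfun
      (hassocV (hmap idfun (tau M) (hassoc (hmap (hcomul Q) idfun t))))) =
    hmap idfun (hcomul Q) (tau M t);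
  tau_counit : forall (M : lmodType H) (t : htens C M),
    hrunit (hmap idfun (hcounit Q) (tau M t)) =
    hlunit (hmap (hcounit Q) idfun t) }.

(* H [x] M = H (x)_{A^e} M, a left H-module; as an A-bimodule it is           *)
(* restr (eta B) (boxm M).                                                    *)
Section Box.
Variable M : lmodType (env A).

Definition boxm : Type :=
  tensor (fun (x : env A) (h : H) => h * eta B x)
         (fun (x : env A) (m : M) => x *: m).
HB.instance Definition _ := GRing.Zmodule.on boxm.

Definition box (h : H) (m : M) : boxm := tens _ _ h m.

Definition boxm_scale (h : H) (t : boxm) : boxm :=
  tlift (fun h' m => box (h * h') m) t.

Let box_bal h : balanced (fun (x : env A) (h : H) => h * eta B x)
  (fun (x : env A) (m : M) => x *: m) (fun h' m => box (h * h') m).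
Proof.
split=> *; rewrite ?mulrDr ?[LHS]tensDl ?[LHS]tensDr // mulrA.
exact: tens_bal.
Qed.

Lemma boxm_scaleE h h' m : boxm_scale h (box h' m) = box (h * h') m.
Proof. exact: tlift_tens. Qed.

Let bscale0 h : boxm_scale h 0 = 0.
Proof. exact: tlift0. Qed.

Let bscaleDr : right_distributive boxm_scale +%R.
Proof. by move=> h t t'; exact: tliftD. Qed.

Let bscaleA h h' t : boxm_scale h (boxm_scale h' t) = boxm_scale (h * h') t.
Proof.
elim/tensor_ind: t => [|t t' IHt IHt'|h1 m]; first by rewrite !bscale0.
  by rewrite !bscaleDr IHt IHt'.
by rewrite -/(box h1 m) !boxm_scaleE mulrA.
Qed.

Let bscale1 : left_id 1 boxm_scale.
Proof.
elim/tensor_ind => [|t t' IHt IHt'|h1 m]; first exact: bscale0.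
  by rewrite bscaleDr IHt IHt'.
by rewrite -/(box h1 m) boxm_scaleE mul1r.
Qed.

Let bscaleDl t : {morph boxm_scale^~ t : h h' / h + h'}.
Proof.
move=> h h'; elim/tensor_ind: t => [|t t' IHt IHt'|h1 m].
- by rewrite !bscale0 addr0.
- by rewrite !bscaleDr IHt IHt' addrACA.
by rewrite -/(box h1 m) !boxm_scaleE mulrDl [LHS]tensDl.
Qed.

HB.instance Definition _ := GRing.Zmodule_isLmodule.Build H boxm
  bscaleA bscale1 bscaleDr bscaleDl.

Lemma boxZ h h' m : h *: box h' m = box (h * h') m.
Proof. exact: boxm_scaleE. Qed.

Lemma boxDl h h' m : box (h + h') m = box h m + box h' m.
Proof. exact: tensDl. Qed.

Lemma boxDr h m m' : box h (m + m') = box h m + box h m'.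
Proof. exact: tensDr. Qed.

Lemma box_bal_env x h m : box (h * eta B x) m = box h (x *: m).
Proof. exact: tens_bal. Qed.

End Box.

Definition boxA : Type := boxm (abim A).
HB.instance Definition _ := GRing.Lmodule.on boxA.

Definition boxa (h : H) (a : A) : boxA := box h (a : abim A).

(* The quotient map H -> H [x] A. *)
Definition boxpr (h : restr (eta B) H^o) : restr (eta B) boxA := boxa h 1.

Let boxpr_is_linear : linear boxpr.
Proof.
move=> x h h'; rewrite [LHS]boxDl; congr (_ + _).
by rewrite [RHS]boxZ.
Qed.

HB.instance Definition _ := GRing.isLinear.Build (env A)
  (restr (eta B) H^o) (restr (eta B) boxA) *:%R boxpr boxpr_is_linear.

Lemma boxpr_box h a : boxa h a = boxpr (h * src a).
Proof.
by rewrite /boxpr /boxa box_bal_env abim_ltE mulr1.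
Qed.

(* H (x)_{A^op} H and H <> H. Since k1 in A acts on both sides as the scalar  *)
(* k in K, these are indeed quotients of H (x)_K H.                           *)
Definition tens_op : Type :=
  tensor (fun (s : A) (h : H) => h * tgt s) (fun (s : A) (h : H) => tgt s * h).
HB.instance Definition _ := GRing.Zmodule.on tens_op.

Definition opten (h h' : H) : tens_op := tens _ _ h h'.

Definition diamond : Type :=
  tensor (fun (s : A) (h : H) => tgt s * h) (fun (s : A) (h : H) => src s * h).
HB.instance Definition _ := GRing.Zmodule.on diamond.

Definition dia (h h' : H) : diamond := tens _ _ h h'.

Definition beta_in (h' : H)
    (d : bimtens (restr (eta B) H^o) (restr (eta B) H^o)) : diamond :=
  @bim_lift _ _ (restr (eta B) H^o) (restr (eta B) H^o) diamond
    (fun h1 h2 : H => dia h1 (h2 * h')) d.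

Definition beta : tens_op -> diamond :=
  tlift (fun h h' => beta_in h' (Delta h)).

Let beta_in_bal h' : @bim_balanced _ _ (restr (eta B) H^o) (restr (eta B) H^o) _
  (fun h1 h2 : H => dia h1 (h2 * h')).
Proof.
split=> [h1 h2 h|h h1 h2|a h1 h2].
- exact: tensDl.
- by rewrite [((h1 : H) + h2) * h']mulrDl [LHS]tensDr.
- rewrite -[rt a *: h1]/(tgt a * h1 : H) -[lt a *: h2]/(src a * h2 : H).
  by rewrite -mulrA; exact: tens_bal.
Qed.

Lemma beta_in_regsum h' u :
  beta_in h' (regsum (eta B) u) = \sum_(x <- u) dia x.1 (x.2 * h').
Proof. exact: (bim_lift_bsum _ (beta_in_bal h')). Qed.

Lemma beta_balanced : balanced (fun (s : A) (h : H) => h * tgt s)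
  (fun (s : A) (h : H) => tgt s * h) (fun h h' => beta_in h' (Delta h)).
Proof.
split=> [h1 h2 h|h h1 h2|a h h'].
- by rewrite Delta_D; exact: bim_liftD (beta_in_bal h).
- have [u ->] := regsum_surj (Delta h); rewrite !beta_in_regsum -big_split /=.
  by apply: eq_bigr => x _; rewrite mulrDr [LHS]tensDr.
have [u hu] := regsum_surj (Delta h).
rewrite hu beta_in_regsum; have := comul_mulr 1 a hu.
rewrite -[comul _ _]/(Delta (h * tgt a)) => ->.
rewrite beta_in_regsum big_map /=; apply: eq_bigr => x _.
by rewrite lt1 rmorph1 mulr1 mulrA.
Qed.

Lemma betaE h h' u : Delta h = regsum (eta B) u ->
  beta (opten h h') = \sum_(x <- u) dia x.1 (x.2 * h').
Proof.
by move=> hu; rewrite [LHS](tlift_tens beta_balanced) hu beta_in_regsum.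
Qed.

End Bialgebroid.

Arguments boxpr {K A H} B h.
Arguments beta {K A H} B _.

(* Main.v *)
From HB Require Import structures.
Require Import Defs.
From mathcomp Require Import all_boot all_algebra.

Set Implicit Arguments.
Unset Strict Implicit.
Unset Printing Implicit Defensive.

Import GRing.Theory.
Local Open Scope ring_scope.

(** Write C for H [x] A, e for the class of 1 in C ([gen]), and a, \overline a
    for the images of a in H; thus h e is the class of h. The proof rests on
    two facts about generators.

    C is the cyclic H-module on e, with defining relations
    a e = \overline a e: an H-linear map C -> N is the same thing as an element
    n of N with a n = \overline a n for all a ([from_gen]). Sending e to
    e (x) e and to the unit of A gives the comultiplication and the
    counit. Associators and unitors are H-linear, so the coalgebra axioms only
    have to be compared on e, where they are evident. The comonoid of
    A-bimodules underlying C inherits its axioms from H instead, along the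
    surjection H -> C ([quotient_comonoid]).

    H <> H is the H-module H (x)_A H, and beta(h (x) k) = h (1 (x) k)
    ([beta_htens]). Since beta is onto, H (x)_A H is generated as an H-module by
    the elements 1 (x) k. As C (x)_A M is a sum of images of H (x)_A H under
    h (x) k |-> h e (x) k m, it is generated by the elements e (x) m
    ([hten_gen_ext]). Hence there is at most one H-linear map tau_M with
    tau_M(e (x) m) = m (x) e, and all the identities of a lax braiding follow
    from their obvious versions on these generators; for instance tau_A = id
    amounts to a e = \overline a e.

    For the existence of tau_M, the injectivity of beta makes the prescription
    h (1 (x) k) |-> h (k m (x) e) a well-defined H-linear map [theta] on
    H (x)_A H, and tau_M(h e (x) m) is its value at h (x) 1 ([braid]). That this
    depends only on h e and is balanced over A is again checked on the elements
    1 (x) k. Writing h (x) 1 as the sum of the h_(+) (1 (x) h_(-)) turns this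
    value into the explicit formula ([braid_formula]). *)

(** * Functoriality of the tensor product of bimodules *)

Section BimoduleMaps.
Variables (K : fieldType) (A : algType K).

Lemma bten_ind3 (M N P : lmodType (env A))
    (R : bimtens (bimtens M N) P -> Prop) :
    R 0 -> (forall u v, R u -> R v -> R (u + v)) ->
    (forall m n p, R (bten (bten m n) p)) ->
  forall t, R t.
Proof.
move=> R0 RD Rt; elim/bten_ind=> // t p.
have b0 : bten (0 : bimtens M N) p = 0.
  by apply: (addIr (bten (0 : bimtens M N) p)); rewrite -btenDl !add0r.
elim/bten_ind: t => [|u v Ru Rv|//]; first by rewrite b0.
by rewrite btenDl; apply: RD.
Qed.

Section Map.
Variables M N M' N' : lmodType (env A).
Variables (f : {linear M -> M'}) (g : {linear N -> N'}).

Lemma bim_map0 : bim_map f g 0 = 0.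
Proof. exact: bim_lift0 (bim_map_balanced f g). Qed.

Lemma bim_mapD u v : bim_map f g (u + v) = bim_map f g u + bim_map f g v.
Proof. exact: bim_liftD (bim_map_balanced f g). Qed.

Lemma bim_map_is_linear : linear (bim_map f g).
Proof.
move=> x u v; rewrite bim_mapD; congr (_ + _).
elim/envt_ind: x => [|x y IHx IHy|a b]; first by rewrite !scale0r bim_map0.
  by rewrite !scalerDl bim_mapD IHx IHy.
elim/bten_ind: u => [|u w IHu IHw|m n].
- by rewrite bim_map0 !scaler0 bim_map0.
- by rewrite scalerDr !bim_mapD IHu IHw scalerDr.
by rewrite bten_scale !bim_mapE bten_scale !linearZ.
Qed.

HB.instance Definition _ := GRing.isLinear.Build (env A)
  (bimtens M N) (bimtens M' N') *:%R (bim_map f g) bim_map_is_linear.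

End Map.

Lemma bim_map_square (M N M1 N1 M2 N2 L P : lmodType (env A))
    (f1 : {linear M -> M1}) (g1 : {linear N -> N1})
    (f1' : {linear M1 -> L}) (g1' : {linear N1 -> P})
    (f2 : {linear M -> M2}) (g2 : {linear N -> N2})
    (f2' : {linear M2 -> L}) (g2' : {linear N2 -> P}) t :
    (forall m, f1' (f1 m) = f2' (f2 m)) ->
    (forall n, g1' (g1 n) = g2' (g2 n)) ->
  bim_map f1' g1' (bim_map f1 g1 t) = bim_map f2' g2' (bim_map f2 g2 t).
Proof.
move=> ff gg; elim/bten_ind: t => [|u v IHu IHv|m n].
- by rewrite !bim_map0.
- by rewrite !bim_mapD IHu IHv.
- by rewrite !bim_mapE ff gg.
Qed.

Lemma bim_assoc0 (M N P : lmodType (env A)) : @bim_assoc _ _ M N P 0 = 0.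
Proof. exact: bim_lift0 (bim_assoc_balanced M N P). Qed.

Lemma bim_assocD (M N P : lmodType (env A)) (u v : bimtens (bimtens M N) P) :
  bim_assoc (u + v) = bim_assoc u + bim_assoc v.
Proof. exact: bim_liftD (bim_assoc_balanced M N P). Qed.

Lemma bim_assoc_natural (M N P M' N' P' : lmodType (env A))
    (f : {linear M -> M'}) (g : {linear N -> N'}) (h : {linear P -> P'}) t :
  bim_assoc (bim_map (bim_map f g) h t) =
  bim_map f (bim_map g h) (bim_assoc t).
Proof.
elim/bten_ind3: t => [|u v IHu IHv|m n p].
- by rewrite bim_map0 !bim_assoc0 bim_map0.
- by rewrite bim_mapD !bim_assocD IHu IHv bim_mapD.
- by rewrite bim_mapE !bim_assocE !bim_mapE /= !bim_mapE bim_assocE.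
Qed.

Lemma bim_lunit_natural (M M' : lmodType (env A)) (f : {linear M -> M'}) t :
  bim_lunit (bim_map idfun f t) = f (bim_lunit t).
Proof.
have uD (N : lmodType (env A)) (u v : bimtens (abim A) N) :
    bim_lunit (u + v) = bim_lunit u + bim_lunit v.
  exact: bim_liftD (bim_lunit_balanced N).
have u0 (N : lmodType (env A)) : @bim_lunit _ _ N 0 = 0.
  exact: bim_lift0 (bim_lunit_balanced N).
elim/bten_ind: t => [|u v IHu IHv|a m].
- by rewrite bim_map0 !u0 linear0.
- by rewrite bim_mapD !uD IHu IHv linearD.
- by rewrite bim_mapE !bim_lunitE linearZ.
Qed.

Lemma bim_runit_natural (M M' : lmodType (env A)) (f : {linear M -> M'}) t :
  bim_runit (bim_map f idfun t) = f (bim_runit t).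
Proof.
have uD (N : lmodType (env A)) (u v : bimtens N (abim A)) :
    bim_runit (u + v) = bim_runit u + bim_runit v.
  exact: bim_liftD (bim_runit_balanced N).
have u0 (N : lmodType (env A)) : @bim_runit _ _ N 0 = 0.
  exact: bim_lift0 (bim_runit_balanced N).
elim/bten_ind: t => [|u v IHu IHv|m a].
- by rewrite bim_map0 !u0 linear0.
- by rewrite bim_mapD !uD IHu IHv linearD.
- by rewrite bim_mapE !bim_runitE linearZ.
Qed.

(** As pi is onto, and d and e are transported from D along pi, the comonoid
    axioms for d and e are the images under pi of those of D, by naturality of
    the associator and the unitors. *)
Section QuotientComonoid.
Variables (X Y : lmodType (env A)) (D : comonoid X) (pi : {linear X -> Y}).
Hypothesis pi_surj : forall y, exists x, y = pi x.
Variables (d : {linear Y -> bimtens Y Y}) (e : {linear Y -> abim A}).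
Hypothesis d_pi : forall x, d (pi x) = bim_map pi pi (comul D x).
Hypothesis e_pi : forall x, e (pi x) = counit D x.

Lemma quotient_comulA y :
  bim_assoc (bim_map d idfun (d y)) = bim_map idfun d (d y).
Proof.
have [x ->] := pi_surj y; rewrite d_pi.
have -> : bim_map d idfun (bim_map pi pi (comul D x)) =
    bim_map (bim_map pi pi) pi (bim_map (comul D) idfun (comul D x)).
  exact: bim_map_square.
rewrite bim_assoc_natural comulA.
by apply: bim_map_square => // n; rewrite /= d_pi.
Qed.

Lemma quotient_counitl y : bim_lunit (bim_map e idfun (d y)) = y.
Proof.
have [x ->] := pi_surj y; rewrite d_pi.
have -> : bim_map e idfun (bim_map pi pi (comul D x)) =
    bim_map idfun pi (bim_map (counit D) idfun (comul D x)).
  exact: bim_map_square.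
by rewrite bim_lunit_natural counitl.
Qed.

Lemma quotient_counitr y : bim_runit (bim_map idfun e (d y)) = y.
Proof.
have [x ->] := pi_surj y; rewrite d_pi.
have -> : bim_map idfun e (bim_map pi pi (comul D x)) =
    bim_map pi idfun (bim_map idfun (counit D) (comul D x)).
  exact: bim_map_square.
by rewrite bim_runit_natural counitr.
Qed.

Definition quotient_comonoid : comonoid Y :=
  Comonoid quotient_comulA quotient_counitl quotient_counitr.

End QuotientComonoid.
End BimoduleMaps.

(** * Linearity of the structure maps of the monoidal category *)

Section MonoidalStructure.
Variables (K : fieldType) (A H : algType K) (B : left_bialgebroid A H).
Implicit Types M N P : lmodType H.

Local Notation src := (src B).
Local Notation tgt := (tgt B).
(* The H-action on A comes from B, which the type hunit A does not mention. *)
Local Notation unitM := (Defs_hunit__canonical__GRing_Lmodule B).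

(** The H-action on M (x)_A N is diagonal, so a map that is equivariant on pure
    tensors is H-linear. *)
Lemma hlift_is_linear M N P (f : M -> N -> P) : h_balanced B f ->
    (forall h m n u, Delta B h = regsum (eta B) u ->
      \sum_(x <- u) f (x.1 *: m) (x.2 *: n) = h *: f m n) ->
  linear (hlift (B := B) f).
Proof.
move=> bal fZ h t t'; rewrite (hliftD _ _ bal); congr (_ + _).
elim/hten_ind: t => [|u v IHu IHv|m n]; first by rewrite !(scaler0, hlift0 bal).
  by rewrite scalerDr !(hliftD _ _ bal) IHu IHv scalerDr.
have [u hu] := regsum_surj (Delta B h).
rewrite (hlift_hten _ _ bal) (htensZ _ _ hu) -(fZ _ _ _ _ hu).
elim/big_rec2: _ => [|x y y' _ <-]; first exact: hlift0.
by rewrite (hliftD _ _ bal) (hlift_hten _ _ bal).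
Qed.

Section Functoriality.
Variables M N M' N' : lmodType H.
Variables (f : {linear M -> M'}) (g : {linear N -> N'}).

Lemma hmap_is_linear : linear (hmap (B := B) f g).
Proof.
apply: hlift_is_linear; first exact: hmap_balanced.
move=> h m n u hu; rewrite (htensZ _ _ hu).
by apply: eq_bigr => x _; rewrite !linearZ.
Qed.

HB.instance Definition _ := GRing.isLinear.Build H
  (htens B M N) (htens B M' N') *:%R (hmap (B := B) f g) hmap_is_linear.

End Functoriality.

Section Units.
Variables (h : H) (u : seq (H * H)).
Hypothesis hu : Delta B h = regsum (eta B) u.

(** The two counit axioms, for an arbitrary representative of Delta h. *)
Lemma sum_src_eps : \sum_(x <- u) src (eps B x.1) * x.2 = h.
Proof.
have bal := bim_map_balanced (counit (bgd_comonoid B)) idfun.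
have := counitl (bgd_comonoid B) h; rewrite -/(Delta B h) hu => <-.
rewrite /regsum; elim/big_rec2: _ => [|x y t _ ->].
  by rewrite bim_map0 /bim_lunit (bim_lift0 (bim_lunit_balanced _)).
rewrite bim_mapD /bim_lunit (bim_liftD _ _ (bim_lunit_balanced _)).
by rewrite bim_mapE; congr (_ + _); rewrite [RHS]bim_lunitE.
Qed.

Lemma sum_tgt_eps : \sum_(x <- u) tgt (eps B x.2) * x.1 = h.
Proof.
have := counitr (bgd_comonoid B) h; rewrite -/(Delta B h) hu => <-.
rewrite /regsum; elim/big_rec2: _ => [|x y t _ ->].
  by rewrite bim_map0 /bim_runit (bim_lift0 (bim_runit_balanced _)).
rewrite bim_mapD /bim_runit (bim_liftD _ _ (bim_runit_balanced _)).
by rewrite bim_mapE; congr (_ + _); rewrite [RHS]bim_runitE.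
Qed.

Lemma Delta_mul_src a : Delta B (h * src a) =
  regsum (eta B) [seq (x.1 * src a, x.2) | x <- u].
Proof.
rewrite [LHS](comul_mulr a 1 hu); congr regsum; apply: eq_map => x.
by rewrite rt1 rmorph1 mulr1.
Qed.

Lemma Delta_mul_tgt a : Delta B (h * tgt a) =
  regsum (eta B) [seq (x.1, x.2 * tgt a) | x <- u].
Proof.
rewrite [LHS](comul_mulr 1 a hu); congr regsum; apply: eq_map => x.
by rewrite lt1 rmorph1 mulr1.
Qed.

End Units.

Section UnitorsAssociator.
Variables M N P : lmodType H.

(** Both sides of equivariance are elements of H applied to m, and they agree by
    the counit axiom for h a. *)
Lemma hlunit_is_linear : linear (@hlunit _ _ _ B M).
Proof.
apply: hlift_is_linear; first exact: hlunit_balanced.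
move=> h a m u hu; rewrite scalerA -(sum_src_eps (Delta_mul_src hu a)).
rewrite big_map scaler_suml; apply: eq_bigr => x _.
by rewrite scalerA.
Qed.

HB.instance Definition _ := GRing.isLinear.Build H
  (htens B unitM M) M *:%R (@hlunit _ _ _ B M) hlunit_is_linear.

(** This uses the counit axiom for h \overline a, together with
    epsilon(h a) = epsilon(h \overline a). *)
Lemma hrunit_is_linear : linear (@hrunit _ _ _ B M).
Proof.
apply: hlift_is_linear; first exact: hrunit_balanced.
move=> h m a u hu; rewrite scalerA -(sum_tgt_eps (Delta_mul_tgt hu a)).
rewrite big_map scaler_suml; apply: eq_bigr => x _.
rewrite scalerA; congr (tgt _ * _ *: _); exact: counit_mulr.
Qed.

HB.instance Definition _ := GRing.isLinear.Build H
  (htens B M unitM) M *:%R (@hrunit _ _ _ B M) hrunit_is_linear.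

Lemma hten0l (n : N) : hten B (0 : M) n = 0.
Proof. by apply: (addIr (hten B (0 : M) n)); rewrite -htenDl !add0r. Qed.

Lemma hten0r (m : M) : hten B m (0 : N) = 0.
Proof. by apply: (addIr (hten B m (0 : N))); rewrite -htenDr !add0r. Qed.

End UnitorsAssociator.

Lemma hten_ind3 M N P (R : htens B (htens B M N) P -> Prop) :
    R 0 -> (forall u v, R u -> R v -> R (u + v)) ->
    (forall m n p, R (hten B (hten B m n) p)) ->
  forall t, R t.
Proof.
move=> R0 RD Rt; elim/hten_ind=> // t p.
elim/hten_ind: t => [|u v Ru Rv|//]; first by rewrite hten0l.
by rewrite htenDl; apply: RD.
Qed.

Section Action.
Variables M N : lmodType H.

Lemma hact_balanced (m : M) (n : N) : @bim_balanced _ _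
  (restr (eta B) H^o) (restr (eta B) H^o) _
  (fun h1 h2 : H => hten B (h1 *: m) (h2 *: n)).
Proof.
split=> [h1 h2 h|h h1 h2|a h1 h2].
- by rewrite [((h1 : H) + h2) *: m]scalerDl htenDl.
- by rewrite [((h1 : H) + h2) *: n]scalerDl htenDr.
- rewrite -[rt a *: h1]/(tgt a * h1 : H) -[lt a *: h2]/(src a * h2 : H).
  by rewrite -!scalerA hten_bal.
Qed.

Lemma hactD (m : M) (n : N) d d' :
  hact (B := B) m n (d + d') = hact m n d + hact m n d'.
Proof. exact: bim_liftD (hact_balanced m n). Qed.

Lemma hact0 (m : M) (n : N) : hact (B := B) m n 0 = 0.
Proof. exact: bim_lift0 (hact_balanced m n). Qed.

Lemma hact_regten (m : M) (n : N) h h' :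
  hact m n (regten (eta B) h h') = hten B (h *: m) (h' *: n).
Proof. exact: bim_lift_bten (hact_balanced m n). Qed.

Lemma hact_Delta (m : M) (n : N) h : hact m n (Delta B h) = h *: hten B m n.
Proof.
have [u hu] := regsum_surj (Delta B h).
by rewrite (htensZ _ _ hu) hu hact_regsum.
Qed.

Lemma hact_lt (m : M) (n : N) a d :
  hact m n (lt a *: d) = src a *: hact (B := B) m n d.
Proof.
elim/bten_ind: d => [|d d' IH IH'|h h'].
- by rewrite scaler0 hact0 scaler0.
- by rewrite scalerDr !hactD IH IH' scalerDr.
rewrite bten_scale [rt 1 *: h']scale1r.
rewrite [LHS](hact_regten m n (src a * h) h').
by rewrite [hact _ _ _]hact_regten hten_srcZ scalerA.
Qed.

End Action.

Section Associator.
Variables M N P : lmodType H.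
Local Notation rH := (restr (eta B) H^o).

Lemma hassoc0 : hassoc (0 : htens B (htens B M N) P) = 0.
Proof. exact: hlift0 (hassoc_balanced B M N P). Qed.

Lemma hassocD (u v : htens B (htens B M N) P) :
  hassoc (u + v) = hassoc u + hassoc v.
Proof. exact: hliftD (hassoc_balanced B M N P). Qed.

(** [act3] lets H (x) (H (x) H) act on m (x) (n (x) p). Applied to the two sides
    of the coassociativity of h it yields the two sides of the H-linearity of
    the associator. *)
Let act2 (m : M) (n : N) (p : P) (x : rH) (t : bimtens rH rH) :
    htens B M (htens B N P) :=
  hten B ((x : H) *: m) (hact n p t : htens B N P).

Let act3 (m : M) (n : N) (p : P) : bimtens rH (bimtens rH rH) ->
    htens B M (htens B N P) :=
  bim_lift (act2 m n p).

Let act3_balanced m n p : bim_balanced (act2 m n p).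
Proof.
rewrite /act2; split=> [x x' t|x t t'|a x t].
- by rewrite [((x : H) + x') *: m]scalerDl htenDl.
- by rewrite hactD htenDr.
- by rewrite hact_lt -hten_bal scalerA.
Qed.

Let act3_coassoc m n p d h : act3 m n p (bim_assoc (bten d (h : rH))) =
  hassoc (hten B (hact m n d) (h *: p)).
Proof.
have A0 := bim_lift0 (act3_balanced m n p).
have AD := bim_liftD _ _ (act3_balanced m n p).
have AE := bim_lift_bten _ _ (act3_balanced m n p).
elim/bten_ind: d => [|d d' IH IH'|x y].
- rewrite hact0 hten0l hassoc0.
  have -> : bten (0 : bimtens rH rH) (h : rH) = 0.
    apply: (addIr (bten (0 : bimtens rH rH) (h : rH))).
    by rewrite -btenDl !add0r.
  by rewrite bim_assoc0; apply: A0.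
- rewrite btenDl bim_assocD [LHS]AD [X in X + _]IH [X in _ + X]IH'.
  by rewrite hactD htenDl hassocD.
- rewrite bim_assocE [LHS]AE /act2 [hact n p _]hact_regten.
  by rewrite [hact m n _]hact_regten hassocE.
Qed.

Lemma hassoc_is_linear : linear (@hassoc _ _ _ B M N P).
Proof.
move=> h t t'; rewrite hassocD; congr (_ + _).
elim/hten_ind3: t => [|u v IHu IHv|m n p].
- by rewrite scaler0 hassoc0 scaler0.
- by rewrite scalerDr !hassocD IHu IHv scalerDr.
have A0 := bim_lift0 (act3_balanced m n p).
have AD := bim_liftD _ _ (act3_balanced m n p).
have AE := bim_lift_bten _ _ (act3_balanced m n p).
have [u hu] := regsum_surj (Delta B h).
rewrite hassocE !(htensZ _ _ hu).
have := congr1 (act3 m n p) (comulA (bgd_comonoid B) h).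
rewrite -/(Delta B h) hu /regsum.
have -> : act3 m n p (bim_map idfun (comul (bgd_comonoid B))
    (\sum_(x <- u) regten (eta B) x.1 x.2)) =
    \sum_(x <- u) hten B (x.1 *: m) (x.2 *: hten B n p).
  elim/big_rec2: _ => [|x y y' _ <-]; first by rewrite bim_map0; apply: A0.
  rewrite bim_mapD [LHS]AD; congr (_ + _).
  by rewrite bim_mapE [LHS]AE /act2 -hact_Delta.
move=> <-; elim/big_rec2: _ => [|x y y' _ IH].
  by rewrite hassoc0 bim_map0 bim_assoc0 [RHS]A0.
rewrite bim_mapD bim_assocD hassocD [RHS]AD; congr (_ + _); last exact: IH.
by rewrite bim_mapE [RHS]act3_coassoc -hact_Delta.
Qed.

HB.instance Definition _ := GRing.isLinear.Build H
  (htens B (htens B M N) P) (htens B M (htens B N P)) *:%R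
  (@hassoc _ _ _ B M N P) hassoc_is_linear.

Lemma hassocK : cancel (@hassoc _ _ _ B M N P) (@hassocV _ _ _ B M N P).
Proof.
have V0 := hlift0 (hassocV_balanced B M N P).
have VD := hliftD _ _ (hassocV_balanced B M N P).
elim/hten_ind3 => [|u v IHu IHv|m n p].
- by rewrite hassoc0; apply: V0.
- by rewrite hassocD [LHS]VD [X in X + _]IHu [X in _ + X]IHv.
- by rewrite hassocE hassocVE.
Qed.

Lemma hassocVK : cancel (@hassocV _ _ _ B M N P) (@hassoc _ _ _ B M N P).
Proof.
have V0 := hlift0 (hassocV_balanced B M N P).
have VD := hliftD _ _ (hassocV_balanced B M N P).
elim/hten_ind=> [|u v IHu IHv|m t].
- by rewrite [hassocV _]V0 hassoc0.
- by rewrite [hassocV _]VD hassocD [X in X + _]IHu [X in _ + X]IHv.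
elim/hten_ind: t => [|u v IHu IHv|n p].
- by rewrite hten0r [hassocV _]V0 hassoc0.
- by rewrite htenDr [hassocV _]VD hassocD [X in X + _]IHu [X in _ + X]IHv.
- by rewrite hassocVE hassocE.
Qed.

Lemma hassocV_is_linear : linear (@hassocV _ _ _ B M N P).
Proof.
move=> h u v; rewrite -{1}[u]hassocVK -{1}[v]hassocVK.
by rewrite -[X in hassocV X](hassoc_is_linear h) hassocK.
Qed.

HB.instance Definition _ := GRing.isLinear.Build H
  (htens B M (htens B N P)) (htens B (htens B M N) P) *:%R
  (@hassocV _ _ _ B M N P) hassocV_is_linear.

End Associator.
End MonoidalStructure.

(** * The cyclic coalgebra H [x] A *)

Section CyclicCoalgebra.
Variables (K : fieldType) (A H : algType K) (B : left_bialgebroid A H).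
Implicit Types M N P : lmodType H.

Local Notation src := (src B).
Local Notation tgt := (tgt B).
Local Notation unitM := (Defs_hunit__canonical__GRing_Lmodule B).

(** The domain is the regular module H^o, so that this is an H-linear map. *)
Definition orbit_map N (n : N) (h : H^o) : N := (h : H) *: n.

Lemma orbit_map_is_linear N (n : N) : linear (orbit_map n).
Proof. by move=> x h h'; rewrite /orbit_map scalerDl scalerA. Qed.

HB.instance Definition _ N (n : N) := GRing.isLinear.Build H H^o N *:%R
  (orbit_map n) (orbit_map_is_linear n).

Lemma src_tgtC a b : src a * tgt b = tgt b * src a.
Proof. by rewrite /src /tgt -!rmorphM rt_ltC. Qed.

Definition gen : boxA B := boxa B 1 1.

Lemma boxa_orbit h a : (boxa B h a : boxA B) = (h * src a) *: gen.
Proof.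
by rewrite [LHS](boxpr_box B h a) /boxpr /boxa [RHS]boxZ mulr1.
Qed.

Lemma orbit_gen_surj (c : boxA B) : exists h : H, c = h *: gen.
Proof.
elim/tensor_ind: c => [|c c' [h ->] [h' ->]|h a].
- by exists 0; rewrite scale0r.
- by exists (h + h'); rewrite scalerDl.
- by exists (h * src a); rewrite -boxa_orbit.
Qed.

Lemma src_gen a : src a *: gen = tgt a *: gen.
Proof.
rewrite ![_ *: gen]boxZ !mulr1 -[src a]mul1r -[tgt a]mul1r.
by rewrite ![LHS]box_bal_env [RHS]box_bal_env abim_ltE abim_rtE mulr1 mul1r.
Qed.

Section Descent.
Variables (Z : zmodType) (phi : H -> Z).
Hypothesis phiD : forall h h', phi (h + h') = phi h + phi h'.
Hypothesis phi_bal : forall h a, phi (h * src a) = phi (h * tgt a).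

(** C is the quotient of H by the left ideal generated by the elements
    a - \overline a, so an additive map on H that identifies h a with
    h \overline a descends to C. *)
Definition descend (c : boxA B) : Z :=
  tlift (fun h (a : abim A) => phi (h * src (a : A))) c.

Lemma descend_balanced : balanced (fun (x : env A) (h : H) => h * eta B x)
  (fun (x : env A) (m : abim A) => x *: m)
  (fun h (a : abim A) => phi (h * src (a : A))).
Proof.
have phi0 : phi 0 = 0 by apply: (addIr (phi 0)); rewrite -phiD !add0r.
have srcD a b : src (a + b) = src a + src b by rewrite /src ltD rmorphD.
have src0 : src 0 = 0 by apply: (addIr (src 0)); rewrite -srcD !add0r.
split=> [h h' a|h a a'|x h a]; first by rewrite mulrDl phiD.
  by rewrite srcD mulrDr phiD.
(* For x = b \overline c this compares h b \overline c a with h (b a c). *)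
elim/envt_ind: x => [|x y IHx IHy|b c].
- by rewrite rmorph0 scale0r src0 !(mulr0, mul0r).
- by rewrite rmorphD mulrDr mulrDl phiD IHx IHy scalerDl srcD mulrDr phiD.
rewrite lt_rt rmorphM -/(src b) -/(tgt c) -scalerA abim_rtE abim_ltE.
rewrite -!mulrA -src_tgtC !mulrA -phi_bal -!mulrA.
by rewrite /src -!rmorphM -!ltM.
Qed.

Lemma descendE h : descend (h *: gen) = phi h.
Proof.
have -> : h *: gen = tens _ _ h (1 : abim A) by rewrite [LHS]boxZ mulr1.
by rewrite [LHS](tlift_tens descend_balanced) /src lt1 rmorph1 mulr1.
Qed.

End Descent.

Section CyclicUniversal.
Variables (N : lmodType H) (n : N).

Definition from_gen : boxA B -> N := descend (orbit_map n).

Hypothesis n_bal : forall a, src a *: n = tgt a *: n.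

Lemma from_genE h : from_gen (h *: gen) = h *: n.
Proof.
apply: descendE => [h1 h2|h1 a]; first exact: scalerDl.
by rewrite /orbit_map -!scalerA n_bal.
Qed.

Lemma from_gen_is_linear : linear from_gen.
Proof.
move=> x c c'; have [h ->] := orbit_gen_surj c.
have [h' ->] := orbit_gen_surj c'.
by rewrite scalerA -scalerDl !from_genE scalerDl scalerA.
Qed.

End CyclicUniversal.

Lemma from_gen_ext N (f g : {linear boxA B -> N}) : f gen = g gen -> f =1 g.
Proof.
by move=> fg c; have [h ->] := orbit_gen_surj c; rewrite !linearZ fg.
Qed.

(** The left action of a passes to the left factor and that of \overline a to
    the right one, and the two agree because the tensor product is over A. *)
Lemma gen2_bal a : src a *: hten B gen gen = tgt a *: hten B gen gen.
Proof. by rewrite hten_srcZ src_gen hten_bal src_gen hten_tgtZ. Qed.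

Lemma unit1_bal a : src a *: (1 : unitM) = tgt a *: (1 : unitM).
Proof. by rewrite hunit_srcE [RHS]hunit_tgtE mulr1 mul1r. Qed.

Definition box_comul := from_gen (hten B gen gen).
Definition box_counit := from_gen (1 : unitM).

HB.instance Definition _ := GRing.isLinear.Build H
  (boxA B) (htens B (boxA B) (boxA B)) *:%R box_comul
  (from_gen_is_linear gen2_bal).
HB.instance Definition _ := GRing.isLinear.Build H
  (boxA B) unitM *:%R box_counit (from_gen_is_linear unit1_bal).

Lemma box_comul_gen : box_comul gen = hten B gen gen.
Proof. by have := from_genE gen2_bal 1; rewrite !scale1r. Qed.

Lemma box_counit_gen : box_counit gen = (1 : unitM).
Proof. by have := from_genE unit1_bal 1; rewrite !scale1r. Qed.

Lemma box_comulA c : hassoc (hmap box_comul idfun (box_comul c)) =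
  hmap idfun box_comul (box_comul c).
Proof.
apply: (@from_gen_ext _ (@hassoc _ _ _ B _ _ _ \o
  (hmap box_comul idfun \o box_comul))
  (hmap idfun box_comul \o box_comul)).
by rewrite /= !box_comul_gen !hmapE /= !box_comul_gen hassocE.
Qed.

Lemma box_counitl c : hlunit (hmap box_counit idfun (box_comul c)) = c.
Proof.
apply: (@from_gen_ext _ (@hlunit _ _ _ B _ \o
  (hmap box_counit idfun \o box_comul))
  idfun).
rewrite /= !box_comul_gen !hmapE /= !box_counit_gen hlunitE.
by rewrite /src lt1 rmorph1 scale1r.
Qed.

Lemma box_counitr c : hrunit (hmap idfun box_counit (box_comul c)) = c.
Proof.
apply: (@from_gen_ext _ (@hrunit _ _ _ B _ \o
  (hmap idfun box_counit \o box_comul))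
  idfun).
rewrite /= !box_comul_gen !hmapE /= !box_counit_gen hrunitE.
by rewrite /tgt rt1 rmorph1 scale1r.
Qed.

Definition box_hcoalgebra : hcoalgebra B (boxA B) :=
  HCoalgebra box_comulA box_counitl box_counitr.

(** The A-bimodule structure of M (x)_A N as a tensor product of bimodules is
    the one restricted from its H-module structure. *)
Lemma htens_restrZ M N (x : env A) (t : htens B M N) :
  (x *: (t : bimtens (restr (eta B) M) (restr (eta B) N))) =
  (eta B x *: t : htens B M N).
Proof.
elim/envt_ind: x => [|x y IHx IHy|a b].
- by rewrite rmorph0 !scale0r.
- by rewrite rmorphD !scalerDl IHx IHy.
elim/hten_ind: t => [|u v IHu IHv|m n]; first by rewrite !scaler0.
  by rewrite !scalerDr IHu IHv.
rewrite bten_scale lt_rt rmorphM -scalerA -/(src a) -/(tgt b).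
by rewrite hten_tgtZ hten_srcZ.
Qed.

(** The same maps as morphisms of A-bimodules. They need names of their own:
    the constants [box_comul] and [box_counit] already carry their H-linear
    structures. *)
Definition bim_box_comul (c : restr (eta B) (boxA B)) :
    bimtens (restr (eta B) (boxA B)) (restr (eta B) (boxA B)) := box_comul c.
Definition bim_box_counit (c : restr (eta B) (boxA B)) : abim A := box_counit c.

Lemma bim_box_comul_is_linear : linear bim_box_comul.
Proof. by move=> x c c'; rewrite /bim_box_comul htens_restrZ -linearP. Qed.

Lemma hunit_restrZ (x : env A) (a : A) :
  (x *: (a : abim A) = eta B x *: (a : unitM) :> A).
Proof.
elim/envt_ind: x => [|x y IHx IHy|b c].
- by rewrite rmorph0 !scale0r.
- by rewrite rmorphD !scalerDl IHx IHy.
rewrite lt_rt rmorphM -!scalerA -/(src b) -/(tgt c).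
by rewrite abim_ltE abim_rtE hunit_srcE hunit_tgtE.
Qed.

Lemma bim_box_counit_is_linear : linear bim_box_counit.
Proof. by move=> x c c'; rewrite /bim_box_counit hunit_restrZ -linearP. Qed.

HB.instance Definition _ := GRing.isLinear.Build (env A)
  _ _ *:%R bim_box_comul bim_box_comul_is_linear.
HB.instance Definition _ := GRing.isLinear.Build (env A)
  _ _ *:%R bim_box_counit bim_box_counit_is_linear.

Lemma boxpr_surj (c : restr (eta B) (boxA B)) :
  exists h : restr (eta B) H^o, c = boxpr B h.
Proof.
by have [h ->] := orbit_gen_surj c; exists h; rewrite [LHS]boxZ mulr1.
Qed.

Lemma boxpr_gen (h : H) : boxpr B h = h *: gen.
Proof. by rewrite [RHS]boxZ mulr1. Qed.

Lemma bim_box_comul_boxpr (h : restr (eta B) H^o) : bim_box_comul (boxpr B h) =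
  bim_map (boxpr B) (boxpr B) (comul (bgd_comonoid B) h).
Proof.
have [u hu] := regsum_surj (Delta B h).
rewrite /bim_box_comul boxpr_gen linearZ /= box_comul_gen (htensZ _ _ hu).
rewrite [comul _ _]hu /regsum; elim/big_rec2: _ => [|x y y' _ ->].
  by rewrite bim_map0.
by rewrite bim_mapD bim_mapE /= !boxpr_gen.
Qed.

Lemma bim_box_counit_boxpr (h : restr (eta B) H^o) :
  bim_box_counit (boxpr B h) = counit (bgd_comonoid B) h.
Proof.
rewrite /bim_box_counit boxpr_gen linearZ /= box_counit_gen.
by rewrite [LHS](_ : _ = eps B (h * src 1)) // /src lt1 rmorph1 mulr1.
Qed.

Definition box_comonoid : comonoid (restr (eta B) (boxA B)) :=
  quotient_comonoid boxpr_surj bim_box_comul_boxpr bim_box_counit_boxpr.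

End CyclicCoalgebra.

(** * The braiding of a left Hopf algebroid *)

Section LeftHopf.
Variables (K : fieldType) (A H : algType K) (B : left_bialgebroid A H).
Implicit Types M N P : lmodType H.

Local Notation src := (src B).
Local Notation tgt := (tgt B).
Local Notation unitM := (Defs_hunit__canonical__GRing_Lmodule B).
Local Notation HH := (htens B H^o H^o).
Local Notation gen := (gen B).
(* Here h and k are read in the regular module. *)
Local Notation ht h k := (@hten _ _ _ B H^o H^o h k).

(** The relations defining H <> H are those of H (x)_A H for the regular module,
    so both types coincide and beta takes values in an H-module. *)
Lemma beta_htens (h k : H) :
  beta B (opten B h k) = h *: ht 1 k :> HH.
Proof.
have [u hu] := regsum_surj (Delta B h).
rewrite (betaE _ hu) (htensZ _ _ hu); apply: eq_bigr => x _.
by rewrite [x.1 *: _]mulr1.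
Qed.

Variable binv : diamond B -> tens_op B.
Hypotheses (betaK : cancel (beta B) binv) (binvK : cancel binv (beta B)).

Lemma beta0 : beta B 0 = 0.
Proof. exact: tlift0 (beta_balanced B). Qed.

Lemma betaD x y : beta B (x + y) = beta B x + beta B y.
Proof. exact: tliftD (beta_balanced B) _ _. Qed.

Lemma binvD x y : binv (x + y) = binv x + binv y.
Proof. by apply: (can_inj betaK); rewrite betaD !binvK. Qed.

Lemma binv0 : binv 0 = 0.
Proof. by rewrite -[in LHS]beta0 betaK. Qed.

(** Surjectivity of beta. *)
Lemma regular_tensor_ind (R : HH -> Prop) :
    R 0 -> (forall u v, R u -> R v -> R (u + v)) ->
    (forall h k : H, R (h *: ht 1 k)) ->
  forall d, R d.
Proof.
move=> R0 RD Rg d; rewrite -[d]binvK.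
elim/tensor_ind: (binv d) => [|x y Rx Ry|h k]; first by rewrite beta0.
  by rewrite betaD; apply: RD.
by rewrite -/(opten B h k) beta_htens.
Qed.

Lemma regular_tensor_ext N (f g : {linear HH -> N}) :
    (forall k : H, f (ht 1 k) = g (ht 1 k)) ->
  f =1 g.
Proof.
move=> fg; elim/regular_tensor_ind => [|u v fgu fgv|h k].
  by rewrite !linear0.
  by rewrite !linearD fgu fgv.
by rewrite !linearZ /= fg.
Qed.

(** h e (x) m is the image of h (x) 1 under the tensor product of the orbit maps
    of e and m, and this H-linear map sends the generators 1 (x) k to
    e (x) k m. *)
Lemma hten_gen_ext M N (f g : {linear htens B (boxA B) M -> N}) :
    (forall m, f (hten B gen m) = g (hten B gen m)) -> f =1 g.
Proof.
move=> fg; elim/hten_ind => [|u v fgu fgv|c m]; first by rewrite !linear0.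
  by rewrite !linearD fgu fgv.
have [h ->] := orbit_gen_surj c.
have -> : hten B (h *: gen) m =
    hmap (orbit_map gen) (orbit_map m) (ht h 1).
  by rewrite hmapE /= /orbit_map scale1r.
apply: (@regular_tensor_ext _ (f \o hmap (orbit_map gen) (orbit_map m))
  (g \o hmap (orbit_map gen) (orbit_map m))) => k.
by rewrite /= hmapE /= /orbit_map scale1r fg.
Qed.

Lemma hten_gen_ext3 M N P
    (f g : {linear htens B (boxA B) (htens B M N) -> P}) :
    (forall m n, f (hten B gen (hten B m n)) = g (hten B gen (hten B m n))) ->
  f =1 g.
Proof.
move=> fg; apply: hten_gen_ext => t.
elim/hten_ind: t => [|u v IHu IHv|//]; first by rewrite hten0r !linear0.
by rewrite htenDr !linearD IHu IHv.
Qed.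

Section Braiding.
Variable M : lmodType H.

Let theta_op (m : M) (h k : H) : htens B M (boxA B) :=
  h *: hten B (k *: m) gen.

Let theta_op_balanced m : balanced (fun (s : A) (h : H) => h * tgt s)
  (fun (s : A) (h : H) => tgt s * h) (theta_op m).
Proof.
rewrite /theta_op; split=> [h h' k|h k k'|a h k]; first exact: scalerDl.
  by rewrite scalerDl htenDl scalerDr.
by rewrite -[in LHS]scalerA hten_tgtZ -src_gen -hten_bal scalerA.
Qed.

(** The H-linear map with h (1 (x) k) |-> h (k m (x) e); it exists because
    beta is injective. *)
Definition theta (m : M) (d : HH) : htens B M (boxA B) :=
  tlift (theta_op m) (binv d).

Lemma thetaE m (h k : H) :
  theta m (h *: ht 1 k) = h *: hten B (k *: m) gen.
Proof.
rewrite /theta -beta_htens betaK.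
exact: (tlift_tens (theta_op_balanced m)).
Qed.

Lemma theta0 m : theta m 0 = 0.
Proof. by rewrite /theta binv0; exact: (tlift0 (theta_op_balanced m)). Qed.

Lemma thetaD m u v : theta m (u + v) = theta m u + theta m v.
Proof. by rewrite /theta binvD; exact: (tliftD (theta_op_balanced m)). Qed.

Lemma theta_is_linear m : linear (theta m).
Proof.
move=> h u v; rewrite thetaD; congr (_ + _).
elim/regular_tensor_ind: u => [|u w IHu IHw|h' k].
  by rewrite scaler0 theta0 scaler0.
  by rewrite scalerDr !thetaD IHu IHw scalerDr.
by rewrite scalerA !thetaE scalerA.
Qed.

HB.instance Definition _ m := GRing.isLinear.Build H
  HH (htens B M (boxA B)) *:%R (theta m) (theta_is_linear m).

Lemma theta_gen m (k : H) :
  theta m (ht 1 k) = hten B (k *: m) gen.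
Proof. by rewrite -[ht 1 k]scale1r thetaE scale1r. Qed.

Lemma thetaDm m m' d : theta (m + m') d = theta m d + theta m' d.
Proof.
elim/regular_tensor_ind: d => [|u v IHu IHv|h k].
  by rewrite !theta0 addr0.
  by rewrite !thetaD IHu IHv addrACA.
by rewrite !thetaE scalerDr htenDl scalerDr.
Qed.

(** Right multiplication by l on the second factor is H-linear, and both sides
    take the value k l m (x) e on 1 (x) k. *)
Lemma theta_mulr m (l h k : H) :
  theta m (ht h (k * l)) =
  theta (l *: m) (ht h k).
Proof.
have -> : ht h (k * l) =
  hmap idfun (orbit_map (l : H^o)) (ht h k) by rewrite hmapE.
apply: (@regular_tensor_ext _
  (theta m \o hmap idfun (orbit_map (l : H^o))) (theta (l *: m))).
by move=> k'; rewrite /= hmapE /= !theta_gen scalerA.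
Qed.

(** Both sides are H-linear in h (x) k, so h may be taken to be 1. Then
    a (x) k = a (1 (x) k) while \overline a (x) k = 1 (x) a k, and both have
    image a k m (x) e. *)
Lemma theta_mul_src m a (h k : H) :
  theta m (ht (h * src a) k) =
  theta m (ht (h * tgt a) k).
Proof.
have E r : ht (h * r) k =
  hmap (orbit_map (r : H^o)) idfun (ht h k) by rewrite hmapE.
rewrite !E; apply: (@regular_tensor_ext _
  (theta m \o hmap (orbit_map (src a : H^o)) idfun)
  (theta m \o hmap (orbit_map (tgt a : H^o)) idfun)) => k'.
rewrite /= !hmapE /= /orbit_map !scale1r.
have -> : ht (src a) k' = src a *: ht 1 k'.
  by rewrite hten_srcZ [src a *: _]mulr1.
have -> : ht (tgt a) k' = ht 1 (src a * k').
  by rewrite -[src a * k']/(src a *: (k' : H^o)) -hten_bal [tgt a *: _]mulr1.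
by rewrite thetaE theta_gen hten_srcZ scalerA.
Qed.

Definition theta1 (m : M) (h : H) := theta m (ht h 1).

Definition braid_pair (c : boxA B) (m : M) : htens B M (boxA B) :=
  descend (theta1 m) c.

Lemma braid_pairE h m :
  braid_pair (h *: gen) m = theta m (ht h 1).
Proof.
apply: (@descendE _ _ _ B _ (theta1 m)) => [h1 h2|h1 a].
  2: exact: theta_mul_src.
by rewrite /theta1 (@htenDl _ _ _ B H^o H^o) thetaD.
Qed.

(** Balancedness over A comes from \overline a h (x) 1 = h (x) a and
    [theta_mulr]. *)
Lemma braid_pair_balanced : h_balanced B braid_pair.
Proof.
split=> [c c' m|c m m'|a c m].
- have [[h ->] [h' ->]] := (orbit_gen_surj c, orbit_gen_surj c').
  by rewrite -scalerDl !braid_pairE (@htenDl _ _ _ B H^o H^o) thetaD.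
- have [h ->] := orbit_gen_surj c.
  by rewrite !braid_pairE thetaDm.
- have [h ->] := orbit_gen_surj c.
  rewrite scalerA !braid_pairE -theta_mulr mul1r; congr theta.
  by have := @hten_bal _ _ _ B H^o H^o a h 1; rewrite [src a *: _]mulr1.
Qed.

Definition braid : htens B (boxA B) M -> htens B M (boxA B) :=
  hlift braid_pair.

(** By [theta_mulr], the sum of the images of g_(1) h e (x) g_(2) m is theta
    at the sum of the g_(1) h (x) g_(2), that is, at g (h (x) 1). *)
Lemma braid_is_linear : linear braid.
Proof.
apply: hlift_is_linear; first exact: braid_pair_balanced.
move=> g c m u hu; have [h ->] := orbit_gen_surj c.
rewrite braid_pairE -linearZ /= (htensZ _ _ hu) linear_sum /=.
apply: eq_bigr => x _.
by rewrite scalerA braid_pairE -theta_mulr mul1r [x.2 *: _]mulr1.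
Qed.

HB.instance Definition _ := GRing.isLinear.Build H
  (htens B (boxA B) M) (htens B M (boxA B)) *:%R braid braid_is_linear.

Lemma braidE h m :
  braid (hten B (h *: gen) m) = theta m (ht h 1).
Proof.
by rewrite -braid_pairE; exact: (hlift_hten _ _ braid_pair_balanced).
Qed.

Lemma braid_gen m : braid (hten B gen m) = hten B m gen.
Proof. by rewrite -[gen in LHS]scale1r braidE theta_gen scale1r. Qed.

(** Expanding h (x) 1 as the sum of the h_(+) (1 (x) h_(-)) and multiplying its
    first factor on the right by a gives the sum of the
    h_(+) a (1 (x) h_(-)). *)
Lemma braid_formula h a m (u : seq (H * H)) (v : H * H -> seq (H * H)) :
    binv (dia B h 1) = \sum_(x <- u) opten B x.1 x.2 ->
    (forall x, x \in u -> Delta B x.1 = regsum (eta B) (v x)) ->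
  braid (hten B (boxa B h a : boxA B) m) =
    \sum_(x <- u) \sum_(y <- v x)
       hten B ((y.1 * src a * x.2) *: m) (boxa B y.2 1 : boxA B).
Proof.
move=> hu hv; rewrite boxa_orbit braidE.
have -> : ht (h * src a) 1 = hmap (orbit_map (src a : H^o)) idfun
    (ht h 1) by rewrite hmapE.
have -> : ht h 1 =
    \sum_(x <- u) x.1 *: ht 1 x.2.
  rewrite -[LHS]binvK -[hten B _ _]/(dia B h 1) hu.
  elim/big_rec2: _ => [|x y y' _ <-]; first exact: beta0.
  by rewrite betaD beta_htens.
pose f : {linear HH -> htens B M (boxA B)} :=
  theta m \o hmap (orbit_map (src a : H^o)) idfun.
rewrite [LHS](linear_sum f); apply: eq_big_seq => x xu.
rewrite linearZ /= hmapE /= /orbit_map scale1r.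
have -> : ht (src a) x.2 = src a *: ht 1 x.2.
  by rewrite hten_srcZ [src a *: _]mulr1.
rewrite thetaE hten_srcZ (htensZ _ _ (hv x xu)); apply: eq_bigr => y _.
by rewrite !scalerA boxa_orbit /src lt1 rmorph1 mulr1.
Qed.

End Braiding.

Lemma braid_natural M N (f : {linear M -> N}) t :
  braid (hmap idfun f t) = hmap f idfun (braid t).
Proof.
apply: (@hten_gen_ext _ _ (@braid N \o hmap idfun f)
  (hmap f idfun \o @braid M)) => m.
by rewrite /= hmapE !braid_gen hmapE.
Qed.

Lemma braid_tensor M N (t : htens B (htens B (boxA B) M) N) :
  hassoc (braid (hassoc t)) =
  hmap idfun (@braid N) (hassoc (hmap (@braid M) idfun t)).
Proof.
suff E (s : htens B (boxA B) (htens B M N)) : hassoc (braid s) =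
    hmap idfun (@braid N) (hassoc (hmap (@braid M) idfun (hassocV s))).
  by have := E (hassoc t); rewrite (hassocK t).
move: s; apply: (@hten_gen_ext3 _ _ _ (@hassoc _ _ _ B _ _ _ \o @braid _)
  (hmap idfun (@braid N) \o (@hassoc _ _ _ B _ _ _ \o
    (hmap (@braid M) idfun \o @hassocV _ _ _ B _ _ _)))) => m n.
rewrite /= braid_gen hassocE hassocVE hmapE /= braid_gen hassocE hmapE /=.
by rewrite braid_gen.
Qed.

Lemma braid_unit (t : htens B (boxA B) unitM) : hlunit (braid t) = hrunit t.
Proof.
apply: (@hten_gen_ext _ _ (@hlunit _ _ _ B _ \o @braid _) (@hrunit _ _ _ B _)).
by move=> a; rewrite /= braid_gen hlunitE hrunitE src_gen.
Qed.

Lemma braid_comul M (t : htens B (boxA B) M) :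
  hassoc (hmap (@braid M) idfun (hassocV (hmap idfun (@braid M)
    (hassoc (hmap (hcomul (box_hcoalgebra B)) idfun t))))) =
  hmap idfun (hcomul (box_hcoalgebra B)) (braid t).
Proof.
apply: (@hten_gen_ext _ _ (@hassoc _ _ _ B _ _ _ \o
  (hmap (@braid M) idfun \o (@hassocV _ _ _ B _ _ _ \o (hmap idfun (@braid M) \o
  (@hassoc _ _ _ B _ _ _ \o hmap (hcomul (box_hcoalgebra B)) idfun)))))
  (hmap idfun (hcomul (box_hcoalgebra B)) \o @braid M)) => m.
rewrite /= braid_gen !hmapE /= !box_comul_gen hassocE hmapE /= braid_gen.
by rewrite hassocVE hmapE /= braid_gen hassocE.
Qed.

Lemma braid_counit M (t : htens B (boxA B) M) :
  hrunit (hmap idfun (hcounit (box_hcoalgebra B)) (braid t)) =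
  hlunit (hmap (hcounit (box_hcoalgebra B)) idfun t).
Proof.
apply: (@hten_gen_ext _ _ (@hrunit _ _ _ B _ \o
  (hmap idfun (hcounit (box_hcoalgebra B)) \o @braid M))
  (@hlunit _ _ _ B _ \o hmap (hcounit (box_hcoalgebra B)) idfun)) => m.
rewrite /= braid_gen !hmapE /= !box_counit_gen hlunitE hrunitE.
by rewrite /src /tgt lt1 rt1.
Qed.

Definition box_braiding : lax_braiding (box_hcoalgebra B) :=
  LaxBraiding (tau := fun M => @braid M) braid_natural braid_tensor braid_unit
    braid_comul braid_counit.

End LeftHopf.

Theorem mainTheorem11 (K : fieldType) (A H : algType K)
    (B : left_bialgebroid A H) :
  exists C : comonoid (restr (eta B) (boxA B)),
    [/\ forall h : H,
          comul C (boxpr B h) = bim_map (boxpr B) (boxpr B) (Delta B h),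
        forall h : H, counit C (boxpr B h) = eps B h
      & forall binv : diamond B -> tens_op B,
          cancel (beta B) binv -> cancel binv (beta B) ->
          exists (Q : hcoalgebra B (boxA B)) (T : lax_braiding Q),
            [/\ hcomul Q =1 comul C,
                hcounit Q =1 counit C
              & forall (M : lmodType H) (h : H) (a : A) (m : M)
                  (u : seq (H * H)) (v : H * H -> seq (H * H)),
                  binv (dia B h 1) = \sum_(x <- u) opten B x.1 x.2 ->
                  (forall x, x \in u -> Delta B x.1 = regsum (eta B) (v x)) ->
                  T M (hten B (boxa B h a : boxA B) m) =
                    \sum_(x <- u) \sum_(y <- v x)
                      hten B ((y.1 * src B a * x.2) *: m)
                             (boxa B y.2 1 : boxA B)]].
Proof.
exists (box_comonoid B).
split=> [h|h|binv betaK binvK].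
- exact: bim_box_comul_boxpr.
- exact: bim_box_counit_boxpr.
exists (box_hcoalgebra B), (box_braiding betaK binvK).
split=> // M h a m u v; exact: braid_formula.
Qed.
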